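(* Let $I$ be a $k$-subset of $\{1,\dots,n\}$ such that the kernel $\Omega(L_I)$ of the projective cover of $L_I$ has rank $r>1$. Then $\Omega^{2n/(n,k)}(L_I)\cong L_I$, where $(n,k)=\gcd(n,k)$, and the minimal projective resolution of $L_I$ is periodic with period an even number dividing $2n/(n,k)$. Moreover, write $I$ as the disjoint union of its maximal cyclic intervals $A_1,\dots,A_{r+1}$, listed in cyclic order, let $d_i=|A_i|$ and let $l_i$ be the number of elements of $\{1,\dots,n\}\setminus I$ lying cyclically between $A_i$ and $A_{i+1}$ (indices modulo $r+1$). Then the period $m$ is given by $$m=2\min\Big\{t\ge 1 \ :\ \exists\, c\in\{1,\dots,r+1\}\ \text{such that}\ d_{c+i}=d_{1+i},\ l_{c+i}=l_{1+i}\ \text{for } i=0,1,\dots,r,\ \text{and}\ kt\equiv\sum_{i=1}^{c-1}(d_i+l_i)\bmod n\Big\}.$$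
   Context: Let $\mathbb F$ be an algebraically closed field, and let $n\ge 2$ and $1\le k\le n-1$ be integers. Elements of $\{1,\dots,n\}$ are read modulo $n$. Let $B$ be the quotient of the path algebra over $\mathbb F$ of the quiver with vertex set $\mathbb Z_n$ and arrows $x_i:i-1\to i$, $y_i:i\to i-1$ ($i\in\mathbb Z_n$) by the relations $xy=yx$ and $x^k=y^{n-k}$, one of each kind starting at every vertex (that is, $x_iy_i=y_{i+1}x_{i+1}$ at vertex $i$, paths composed as functions, and the length-$k$ path of $x$'s from $i$ to $i+k$ equals the length-$(n-k)$ path of $y$'s from $i$ to $i+k$). Its centre is $Z=\mathbb F[t]$, $t=\sum_i x_iy_i$ (not to be confused with the integer $t$ in the claim). Modules are left modules, i.e. representations of the quiver. The rank of a $B$-module $M$ is the length of $M\otimes_Z K$ over $B\otimes_Z K\cong M_n(K)$, $K$ being the fraction field of $Z$. For a $k$-subset $I\subseteq\{1,\dots,n\}$, the rank $1$ module $L_I$ has a copy $U_i=\mathbb F[t]$ at each vertex $i$; $x_i:U_{i-1}\to U_i$ is multiplication by $1$ if $i\in I$ and by $t$ if $i\notin I$; $y_i:U_i\to U_{i-1}$ is multiplication by $t$ if $i\in I$ and by $1$ if $i\notin I$. Every rank $1$ module that is free over $Z$ is isomorphic to $L_I$ for a unique $I$. Put $P_j=Be_j$. Syzygies. Let $U=\{u\notin I: u+1\in I\}$ (peaks) and $V=\{v\in I: v+1\notin I\}$ (valleys). The projective cover of $L_I$ is $\pi:\bigoplus_{u\in U}P_u\to L_I$, $e_u\mapsto 1\in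 U_u$, and $\Omega(L_I)=\ker\pi$ has rank $|U|-1$. Assume $|U|\ge2$. Then $\Omega(L_I)$ is the image of $D:\bigoplus_{v\in V}P_v\to\bigoplus_{u\in U}P_u$ sending $e_v$ to $x^{v-u_-}-y^{u_+-v}$, where $u_-$ and $u_+$ are the elements of $U$ immediately preceding and following $v$ in cyclic order, $x^{v-u_-}\in P_{u_-}$ is the path of $x$'s from $u_-$ to $v$, and $y^{u_+-v}\in P_{u_+}$ is the path of $y$'s from $u_+$ to $v$. Put $\Omega^2(L_I)=\ker D$. This is again a rank $1$ module free over $Z$, hence isomorphic to some $L_{I'}$, so the construction is iterated: $\Omega^1=\Omega$, $\Omega^{m+2}(L_I)=\Omega^m(\Omega^2(L_I))$. Splicing gives the minimal projective resolution of $L_I$. Its period (the period of $L_I$) is the smallest $m\ge1$ with $\Omega^m(L_I)\cong L_I$. *)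

(* Defs.v *)
From HB Require Import structures.
From mathcomp Require Import all_boot all_order all_algebra.
From mathcomp Require Import finmap.
From mathcomp.multinomials Require Import xfinmap monalg.
From mathcomp Require Import boolp zify.

Set Implicit Arguments.
Unset Strict Implicit.
Unset Printing Implicit Defensive.

Import GRing.Theory.

Local Open Scope ring_scope.

Section Submodules.
Variable R : pzRingType.

Record submodule (M : lmodType R) := Submodule {
  submod_car :> M -> Prop;
  submod0 : submod_car 0;
  submodP : forall (a : R) (u v : M),
    submod_car u -> submod_car v -> submod_car (a *: u + v)
}.

Definition submod_pred (M : lmodType R) (N : submodule M) : pred M :=
  fun m => `[< N m >].

Lemma submod_pred_closed (M : lmodType R) (N : submodule M) :
  GRing.subsemimod_closed (submod_pred N).
Proof.
split; first split.
- by apply/asboolP; exact: submod0.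
- move=> u v /asboolP Nu /asboolP Nv; apply/asboolP.
  by rewrite -[u]scale1r; exact: submodP.
- move=> a u /asboolP Nu; apply/asboolP.
  by rewrite -[_ *: _]addr0; apply: submodP => //; exact: submod0.
Qed.

Record submod_of (M : lmodType R) (N : submodule M) :=
  SubmodOf { submod_val : M; _ : submod_pred N submod_val }.

HB.instance Definition _ M N := [isSub for @submod_val M N].
HB.instance Definition _ M N := [Choice of @submod_of M N by <:].
HB.instance Definition _ M N :=
  GRing.SubChoice_isSubLmodule.Build R M (@submod_pred M N)
    (@submod_of M N) (submod_pred_closed N).

Lemma ker_submodP (M N : lmodType R) (f : {linear M -> N}) (a : R) (u v : M) :
  f u = 0 -> f v = 0 -> f (a *: u + v) = 0.
Proof. by move=> fu fv; rewrite linearP fu fv scaler0 addr0. Qed.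

Definition ker (M N : lmodType R) (f : {linear M -> N}) : submodule M :=
  Submodule (linear0 f) (@ker_submodP M N f).

Definition lmod_iso (M N : lmodType R) : Prop :=
  exists f : {linear M -> N}, bijective f.

End Submodules.

(* The rank of a module over a ring whose centre Z is a domain.  The module *)
(* W = M (x)_Z K is the localization of M at Z \ {0}; its (R (x)_Z K)-sub-  *)
(* modules are the R-submodules stable under division by Z \ {0}.           *)

Section Rank.
Variable R : pzRingType.

Definition central (z : R) : Prop := forall b : R, z * b = b * z.

Definition is_generic_localization (M W : lmodType R) (f : {linear M -> W})
    : Prop :=
  [/\ forall z : R, central z -> z != 0 -> bijective (fun w : W => z *: w),
      forall m : M, f m = 0 ->
        exists z : R, [/\ central z, z != 0 & z *: m = 0]
    & forall w : W, exists z : R, exists m : M,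
        [/\ central z, z != 0 & z *: w = f m]].

Definition divisible_submod (W : lmodType R) (N : submodule W) : Prop :=
  forall (z : R) (w : W), central z -> z != 0 -> N (z *: w) -> N w.

Definition sub_submod (W : lmodType R) (N N' : submodule W) : Prop :=
  forall w : W, N w -> N' w.

Definition has_generic_length (W : lmodType R) (r : nat) : Prop :=
  exists N : nat -> submodule W,
    [/\ forall w : W, N 0%N w <-> w = 0,
        forall w : W, N r w,
        forall i, (i <= r)%N -> divisible_submod (N i)
      & forall i, (i < r)%N ->
        [/\ sub_submod (N i) (N i.+1), ~ sub_submod (N i.+1) (N i)
          & forall N' : submodule W, divisible_submod N' ->
              sub_submod (N i) N' -> sub_submod N' (N i.+1) ->
              sub_submod N' (N i) \/ sub_submod (N i.+1) N']].

Definition has_rank (M : lmodType R) (r : nat) : Prop :=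
  exists (W : lmodType R) (f : {linear M -> W}),
    is_generic_localization f /\ has_generic_length W r.

End Rank.

Record ideal2 (R : pzRingType) := Ideal2 {
  ideal2_car :> R -> Prop;
  ideal2_0 : ideal2_car 0;
  ideal2_B : forall a b : R, ideal2_car a -> ideal2_car b -> ideal2_car (a - b);
  ideal2_Ml : forall a b : R, ideal2_car b -> ideal2_car (a * b);
  ideal2_Mr : forall a b : R, ideal2_car a -> ideal2_car (a * b)
}.

Section GeneratedIdeal.
Variables (R : pzRingType) (S : R -> Prop).

Definition ideal2_gen_car (a : R) : Prop :=
  forall J : ideal2 R, (forall s : R, S s -> J s) -> J a.

Definition ideal2_gen : ideal2 R.
Proof.
apply: (@Ideal2 R ideal2_gen_car) => [J _|a b Ja Jb J SJ|a b Jb J SJ|a b Ja J SJ].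
- exact: ideal2_0.
- by apply: ideal2_B; [exact: Ja|exact: Jb].
- by apply: ideal2_Ml; exact: Jb.
- by apply: ideal2_Mr; exact: Ja.
Defined.

End GeneratedIdeal.

Section QuotientRing.
Variables (R : pzRingType) (J : ideal2 R).

Definition ideal2_pred : {pred R} := fun a => `[< J a >].

Lemma ideal2_zmod_closed : GRing.zmod_closed ideal2_pred.
Proof.
split=> [|a b /asboolP Ja /asboolP Jb]; apply/asboolP; first exact: ideal2_0.
exact: ideal2_B.
Qed.

HB.instance Definition _ :=
  GRing.isZmodClosed.Build R ideal2_pred ideal2_zmod_closed.

Definition quot_ring := Quotient.quot (ideal2_pred : zmodClosed R).

HB.instance Definition _ := GRing.Zmodule.on quot_ring.

Definition quot_class (a : R) : quot_ring :=
  (\pi_(Quotient.quot (ideal2_pred : zmodClosed R)) a)%qT.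
Definition quot_repr (b : quot_ring) : R :=
  repr (b : Quotient.quot (ideal2_pred : zmodClosed R)).

Lemma quot_reprK (b : quot_ring) : quot_class (quot_repr b) = b.
Proof. exact: reprK. Qed.

Lemma quot_classP (a b : R) : quot_class a = quot_class b <-> J (a - b).
Proof.
split=> [/eqP|Jab]; first by rewrite -Quotient.idealrBE => /asboolP.
by apply/eqP; rewrite -Quotient.idealrBE; apply/asboolP.
Qed.

Lemma quot_classB (a b : R) :
  quot_class (a - b) = quot_class a - quot_class b.
Proof. exact: raddfB. Qed.

Lemma quot_classD (a b : R) :
  quot_class (a + b) = quot_class a + quot_class b.
Proof. exact: raddfD. Qed.

Definition quot_mul (a b : quot_ring) : quot_ring :=
  quot_class (quot_repr a * quot_repr b).

Lemma quot_class_mul (a b : R) :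
  quot_class (a * b) = quot_mul (quot_class a) (quot_class b).
Proof.
apply/quot_classP; set a' := quot_repr _; set b' := quot_repr _.
have Ja : J (a - a') by apply/quot_classP; rewrite quot_reprK.
have Jb : J (b' - b) by apply/quot_classP; rewrite quot_reprK.
have -> : a * b - a' * b' = (a - a') * b - a' * (b' - b).
  by rewrite mulrBl mulrBr opprB addrA subrK.
by apply: ideal2_B; [exact: ideal2_Mr|exact: ideal2_Ml].
Qed.

Lemma quot_mulA : associative quot_mul.
Proof.
move=> a b c; rewrite -[a]quot_reprK -[b]quot_reprK -[c]quot_reprK.
by rewrite -!quot_class_mul mulrA.
Qed.

Lemma quot_mul1r : left_id (quot_class 1) quot_mul.
Proof. by move=> a; rewrite -[a]quot_reprK -quot_class_mul mul1r. Qed.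

Lemma quot_mulr1 : right_id (quot_class 1) quot_mul.
Proof. by move=> a; rewrite -[a]quot_reprK -quot_class_mul mulr1. Qed.

Lemma quot_mulDl : left_distributive quot_mul +%R.
Proof.
move=> a b c; rewrite -[a]quot_reprK -[b]quot_reprK -[c]quot_reprK.
by rewrite -quot_classD -!quot_class_mul -quot_classD mulrDl.
Qed.

Lemma quot_mulDr : right_distributive quot_mul +%R.
Proof.
move=> a b c; rewrite -[a]quot_reprK -[b]quot_reprK -[c]quot_reprK.
by rewrite -quot_classD -!quot_class_mul -quot_classD mulrDr.
Qed.

HB.instance Definition _ := GRing.Zmodule_isPzRing.Build quot_ring
  quot_mulA quot_mul1r quot_mulr1 quot_mulDl quot_mulDr.

End QuotientRing.

Lemma malgZU (K : choiceType) (F : nzRingType) (c d : F) (p : K) :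
  c *: << d *g p >> = << c * d *g p >> :> {malg F[K]}.
Proof. by apply/malgP=> q; rewrite mcoeffZ !mcoeffU mulrnAr. Qed.

Lemma biadditive_assoc (V : zmodType) (G : V -> Prop) (m : V -> V -> V) :
  (forall P : V -> Prop, P 0 -> (forall f g, P f -> P g -> P (f + g)) ->
     (forall f, G f -> P f) -> forall f, P f) ->
  left_distributive m +%R -> right_distributive m +%R ->
  (forall f g h, G f -> G g -> G h -> m f (m g h) = m (m f g) h) ->
  associative m.
Proof.
move=> indV mDl mDr mA.
have m0l f : m 0 f = 0 by apply: (addrI (m 0 f)); rewrite -mDl !addr0.
have m0r f : m f 0 = 0 by apply: (addrI (m f 0)); rewrite -mDr !addr0.
move=> f g h; elim/indV: f => [|f1 f2 IH1 IH2|f Gf].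
- by rewrite !m0l.
- by rewrite !mDl IH1 IH2.
elim/indV: g => [|g1 g2 IH1 IH2|g Gg].
- by rewrite !(m0l, m0r).
- by rewrite !(mDl, mDr) IH1 IH2.
elim/indV: h => [|h1 h2 IH1 IH2|h Gh].
- by rewrite !m0r.
- by rewrite !mDr IH1 IH2.
exact: mA.
Qed.

(* The path algebra of the quiver with vertices 'Z_n and arrows              *)
(* x_i : i-1 -> i, y_i : i -> i-1.  Each vertex is the source of exactly one *)
(* x and one y, so a path is a pair (source, word) with true for x and false *)
(* for y.  Words are read from right to left, as compositions of functions.  *)

Definition qpath (n : nat) : choiceType := ('Z_n * seq bool)%type.

Definition psrc n (p : qpath n) : 'Z_n := p.1.
Definition ptgt n (p : qpath n) : 'Z_n :=
  foldr (fun (b : bool) (i : 'Z_n) => if b then i + 1 else i - 1) p.1 p.2.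

Lemma ptgt_cat n (s : 'Z_n) (v w : seq bool) :
  ptgt ((s, v ++ w) : qpath n) = ptgt ((ptgt ((s, w) : qpath n), v) : qpath n).
Proof. by rewrite /ptgt /= foldr_cat. Qed.

Definition pathalg (F : fieldType) (n : nat) := {malg F[qpath n]}.

HB.instance Definition _ F n := Choice.on (pathalg F n).

(* The operations are locked copies of those of {malg F[qpath n]}, which     *)
(* unification would otherwise unfold.                                       *)
HB.lock Definition pathalg_zero (F : fieldType) n : pathalg F n :=
  0 : {malg F[qpath n]}.
HB.lock Definition pathalg_opp (F : fieldType) n (f : pathalg F n)
  : pathalg F n := - (f : {malg F[qpath n]}).
HB.lock Definition pathalg_add (F : fieldType) n (f g : pathalg F n)
  : pathalg F n := (f : {malg F[qpath n]}) + (g : {malg F[qpath n]}).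
HB.lock Definition pathalg_scale (F : fieldType) n (c : F) (f : pathalg F n)
  : pathalg F n := c *: (f : {malg F[qpath n]}).
HB.lock Definition pvec (F : fieldType) n (p : qpath n) : pathalg F n := << p >>.

Section PathModule.
Variables (F : fieldType) (n : nat).
Local Notation pathalg := (pathalg F n).
Local Notation pathalg_zero := (@pathalg_zero F n).
Local Notation pathalg_opp := (@pathalg_opp F n).
Local Notation pathalg_add := (@pathalg_add F n).
Local Notation pathalg_scale := (@pathalg_scale F n).

Lemma pathalg_addA : associative pathalg_add.
Proof. by move=> f g h; rewrite pathalg_add.unlock addrA. Qed.
Lemma pathalg_addC : commutative pathalg_add.
Proof. by move=> f g; rewrite pathalg_add.unlock addrC. Qed.
Lemma pathalg_add0 : left_id pathalg_zero pathalg_add.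
Proof. by move=> f; rewrite pathalg_add.unlock pathalg_zero.unlock add0r. Qed.
Lemma pathalg_addN : left_inverse pathalg_zero pathalg_opp pathalg_add.
Proof.
move=> f; rewrite pathalg_add.unlock pathalg_zero.unlock pathalg_opp.unlock.
exact: addNr.
Qed.

HB.instance Definition _ := GRing.isZmodule.Build pathalg
  pathalg_addA pathalg_addC pathalg_add0 pathalg_addN.

Lemma pathalg_scaleA c d f :
  pathalg_scale c (pathalg_scale d f) = pathalg_scale (c * d) f.
Proof. by rewrite pathalg_scale.unlock scalerA. Qed.
Lemma pathalg_scale1 : left_id 1 pathalg_scale.
Proof. by move=> f; rewrite pathalg_scale.unlock scale1r. Qed.
Lemma pathalg_scaleDr : right_distributive pathalg_scale +%R.
Proof.
move=> c f g; rewrite pathalg_scale.unlock /GRing.add /= pathalg_add.unlock.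
exact: scalerDr.
Qed.
Lemma pathalg_scaleDl f : {morph pathalg_scale^~ f : c d / c + d}.
Proof.
move=> c d; rewrite pathalg_scale.unlock [RHS]/GRing.add /= pathalg_add.unlock.
exact: scalerDl.
Qed.

HB.instance Definition _ := GRing.Zmodule_isLmodule.Build F pathalg
  pathalg_scaleA pathalg_scale1 pathalg_scaleDr pathalg_scaleDl.

Lemma pathalg_ind (P : pathalg -> Prop) :
  P 0 -> (forall f g : pathalg, P f -> P g -> P (f + g)) ->
  (forall (c : F) (p : qpath n), P (c *: pvec F p)) -> forall f, P f.
Proof.
move=> P0 PD PU f; have {}P0 : P (0 : {malg F[qpath n]}).
  by move: P0; rewrite /GRing.zero /= pathalg_zero.unlock.
rewrite (monalgE (f : {malg F[qpath n]})); elim/big_ind: _ => // [g h Pg Ph|p _].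
  by have := PD _ _ Pg Ph; rewrite {1}/GRing.add /= pathalg_add.unlock.
have := PU (mcoeff p f) p; rewrite {1}/GRing.scale /= pathalg_scale.unlock.
by rewrite pvec.unlock malgZU mulr1.
Qed.

Section LinearExtension.
Variables (S : nzRingType) (phi : {rmorphism F -> S}) (V : lmodType S).
Variable h : qpath n -> V.

Definition lext (f : pathalg) : V :=
  \sum_(p <- msupp (f : {malg F[qpath n]})) phi (mcoeff p f) *: h p.

Lemma lextEw (d : {fset qpath n}) (f : pathalg) :
  (msupp (f : {malg F[qpath n]}) `<=` d)%fset ->
  lext f = \sum_(p <- d) phi (mcoeff p f) *: h p.
Proof.
move=> le; rewrite [LHS](big_fset_incl _ le) => //= x xd /mcoeff_outdom ->.
by rewrite raddf0 scale0r.
Qed.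

Lemma lextU c p : lext (c *: pvec F p) = phi c *: h p.
Proof.
rewrite {1}/GRing.scale /= pathalg_scale.unlock pvec.unlock malgZU mulr1.
by rewrite (lextEw msuppU_le) big_seq_fset1 mcoeffUU.
Qed.

Lemma lextD f g : lext (f + g) = lext f + lext g.
Proof.
rewrite {1}/GRing.add /= pathalg_add.unlock.
pose d := (msupp (f : {malg F[qpath n]}) `|` msupp (g : {malg F[qpath n]}))%fset.
rewrite !(@lextEw d) ?fsubsetUl ?fsubsetUr ?msuppD_le //.
rewrite -big_split; apply: eq_bigr => p _ /=.
by rewrite mcoeffD raddfD scalerDl.
Qed.

Lemma lext0 : lext 0 = 0.
Proof. by apply: (addrI (lext 0)); rewrite -lextD !addr0. Qed.

Lemma lextB f g : lext (f - g) = lext f - lext g.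
Proof. by apply: (addIr (lext g)); rewrite -lextD !subrK. Qed.

End LinearExtension.

Lemma lext_funD (S : nzRingType) (phi : {rmorphism F -> S}) (V : lmodType S)
    (h1 h2 : qpath n -> V) f :
  lext phi (fun p => h1 p + h2 p) f = lext phi h1 f + lext phi h2 f.
Proof.
by rewrite /lext -big_split; apply: eq_bigr => p _; rewrite scalerDr.
Qed.

Lemma eq_lext (S : nzRingType) (phi : {rmorphism F -> S}) (V : lmodType S)
    (h1 h2 : qpath n -> V) f : h1 =1 h2 -> lext phi h1 f = lext phi h2 f.
Proof. by move=> eq_h; apply: eq_bigr => p _; rewrite eq_h. Qed.

End PathModule.

Definition basis_mul (F : fieldType) n (q p : qpath n) : pathalg F n :=
  if ptgt p == psrc q then pvec F (psrc p, q.2 ++ p.2) else 0.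

HB.lock Definition pathalg_mul (F : fieldType) n (g f : pathalg F n)
    : pathalg F n :=
  lext (idfun : {rmorphism F -> F})
    (fun q => lext (idfun : {rmorphism F -> F}) (@basis_mul F n q) f) g.

HB.lock Definition pathalg_one (F : fieldType) n : pathalg F n :=
  \sum_(i : 'Z_n) pvec F (i, [::]).

Section PathAlgebra.
Variables (F : fieldType) (n : nat).
Local Notation pathalg := (pathalg F n).
Local Notation pvec := (@pvec F n).
Local Notation pathalg_mul := (@pathalg_mul F n).
Local Notation pathalg_one := (@pathalg_one F n).

Lemma pathalg_mulDl : left_distributive pathalg_mul +%R.
Proof. by move=> f g h; rewrite pathalg_mul.unlock lextD. Qed.

Lemma pathalg_mulDr : right_distributive pathalg_mul +%R.
Proof.
move=> f g h; rewrite pathalg_mul.unlock -lext_funD.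
by apply: eq_lext => q; rewrite lextD.
Qed.

Lemma pathalg_mul0r f : pathalg_mul 0 f = 0.
Proof. by rewrite pathalg_mul.unlock; exact: lext0. Qed.

Lemma pathalg_mulr0 f : pathalg_mul f 0 = 0.
Proof.
by apply: (addrI (pathalg_mul f 0)); rewrite -pathalg_mulDr !addr0.
Qed.

Lemma pathalg_mulUU c q d p :
  pathalg_mul (c *: pvec q) (d *: pvec p) =
  if ptgt p == psrc q then (c * d) *: pvec (psrc p, q.2 ++ p.2) else 0.
Proof.
rewrite pathalg_mul.unlock !lextU /= /basis_mul.
by case: eqP => _; rewrite ?scaler0 // scalerA.
Qed.

Lemma pathalg_mulA : associative pathalg_mul.
Proof.
apply: (@biadditive_assoc _ (fun f => exists c p, f = c *: pvec p)).
- by move=> P P0 PD PU; apply: pathalg_ind => // c p; apply: PU; exists c, p.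
- exact: pathalg_mulDl.
- exact: pathalg_mulDr.
move=> _ _ _ [c [q ->]] [d [p ->]] [e [r ->]].
case: q p r => [q1 q2] [p1 p2] [r1 r2].
rewrite !pathalg_mulUU /psrc /=.
have [Er|Er] := eqVneq (ptgt _) p1; last first.
  rewrite pathalg_mulr0; case: ifP => _; last by rewrite pathalg_mul0r.
  by rewrite pathalg_mulUU (negbTE Er).
rewrite pathalg_mulUU /psrc /= ptgt_cat Er.
case: ifP => Ep; last by rewrite pathalg_mul0r.
by rewrite pathalg_mulUU /psrc /= Er eqxx mulrA catA.
Qed.

Lemma pathalg_mul1r : left_id pathalg_one pathalg_mul.
Proof.
move=> f; elim/pathalg_ind: f => [|f1 f2 IH1 IH2|c p].
- exact: pathalg_mulr0.
- by rewrite pathalg_mulDr IH1 IH2.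
rewrite pathalg_one.unlock (big_morph (pathalg_mul^~ _)
  (fun f g => pathalg_mulDl f g _) (pathalg_mul0r _)).
have E (i : 'Z_n) : pathalg_mul (pvec (i, [::])) (c *: pvec p) =
    if ptgt p == i then c *: pvec p else 0.
  by rewrite -[pvec (i, _)]scale1r pathalg_mulUU mul1r; case: p.
rewrite (bigD1 (ptgt p)) //= big1 => [|i /negbTE ip].
  by rewrite addr0 E eqxx.
by rewrite E eq_sym ip.
Qed.

Lemma pathalg_mulr1 : right_id pathalg_one pathalg_mul.
Proof.
move=> f; elim/pathalg_ind: f => [|f1 f2 IH1 IH2|c p].
- exact: pathalg_mul0r.
- by rewrite pathalg_mulDl IH1 IH2.
rewrite pathalg_one.unlock (big_morph (pathalg_mul _)
  (fun f g => pathalg_mulDr _ f g) (pathalg_mulr0 _)).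
have E (i : 'Z_n) : pathalg_mul (c *: pvec p) (pvec (i, [::])) =
    if i == psrc p then c *: pvec p else 0.
  rewrite -[pvec (i, _)]scale1r pathalg_mulUU mulr1 /ptgt /psrc /= cats0.
  by case: eqP => // ->; case: p.
rewrite (bigD1 (psrc p)) //= big1 => [|i /negbTE ip].
  by rewrite addr0 E eqxx.
by rewrite E ip.
Qed.

HB.instance Definition _ := GRing.Zmodule_isPzRing.Build pathalg
  pathalg_mulA pathalg_mul1r pathalg_mulr1 pathalg_mulDl pathalg_mulDr.

End PathAlgebra.

Section AlgebraB.
Variables (F : fieldType) (n k : nat).

Definition xpath (i : 'Z_n) (a : nat) : qpath n := (i, nseq a true).
Definition ypath (i : 'Z_n) (a : nat) : qpath n := (i, nseq a false).

Definition B_relation (f : pathalg F n) : Prop :=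
  exists i : 'Z_n,
    f = pvec F (i, [:: true; false]) - pvec F (i, [:: false; true])
    \/ f = pvec F (xpath i k) - pvec F (ypath i (n - k)).

Definition B := quot_ring (ideal2_gen B_relation).

HB.instance Definition _ := GRing.PzRing.on B.

Definition Bclass (f : pathalg F n) : B := quot_class _ f.
Definition Brepr (b : B) : pathalg F n := quot_repr b.

Definition idem (j : 'Z_n) : B := Bclass (pvec F (j, [::])).

End AlgebraB.

Definition ksubset (n k : nat) := {I : {set 'Z_n} | #|I| == k}.

(* The component at vertex i of v : L_I is v i 0. *)
Definition rank1 (F : fieldType) (n k : nat) (n_gt1 : (1 < n)%N)
  (I : ksubset n k) : Type := 'cV[{poly F}]_(Zp_trunc n).+2.

HB.instance Definition _ F n k n_gt1 I := GRing.Zmodule.on (@rank1 F n k n_gt1 I).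

Section RankOne.
Variables (F : fieldType) (n k : nat) (n_gt1 : (1 < n)%N) (I : ksubset n k).

Local Notation N := (Zp_trunc n).+2.

(* The arrow leaving vertex j is x_(j+1) for true and y_j for false.         *)
Definition arrow_coef (b : bool) (j : 'Z_n) : {poly F} :=
  if b then (if j + 1 \in val I then 1 else 'X)
  else (if j \in val I then 'X else 1).

Fixpoint word_coef (j : 'Z_n) (w : seq bool) : {poly F} :=
  if w is b :: w' then
    arrow_coef b (ptgt ((j, w') : qpath n)) * word_coef j w'
  else 1.

Definition path_mx (p : qpath n) : 'M[{poly F}]_N :=
  word_coef p.1 p.2 *: delta_mx (ptgt p) (psrc p).

Definition rep_mx (f : pathalg F n) : 'M[{poly F}]_N :=
  lext (@polyC F : {rmorphism F -> {poly F}}) path_mx f.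

Lemma word_coef_cat j v w :
  word_coef j (v ++ w) =
  word_coef (ptgt ((j, w) : qpath n)) v * word_coef j w.
Proof.
elim: v => [|b v IH] /=; first by rewrite mul1r.
by rewrite IH mulrA ptgt_cat.
Qed.

Lemma path_mxM (q p : qpath n) :
  path_mx q *m path_mx p =
  if ptgt p == psrc q then path_mx (psrc p, q.2 ++ p.2) else 0.
Proof.
case: q p => [i v] [j w]; rewrite /path_mx /psrc /= -scalemxAl -scalemxAr.
case: eqP => [<-|/eqP ne]; last first.
  by rewrite mul_delta_mx_0 ?scaler0 // eq_sym.
by rewrite mul_delta_mx scalerA word_coef_cat ptgt_cat.
Qed.

Lemma rep_mxD f g : rep_mx (f + g) = rep_mx f + rep_mx g.
Proof. exact: lextD. Qed.

Lemma rep_mxB f g : rep_mx (f - g) = rep_mx f - rep_mx g.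
Proof. exact: lextB. Qed.

Lemma rep_mx0 : rep_mx 0 = 0.
Proof. exact: lext0. Qed.

Lemma rep_mxU c p : rep_mx (c *: pvec F p) = c%:P *: path_mx p.
Proof. exact: lextU. Qed.

Lemma rep_mx_pvec p : rep_mx (pvec F p) = path_mx p.
Proof. by rewrite -[pvec F p]scale1r rep_mxU scale1r. Qed.

Lemma rep_mxM f g : rep_mx (f * g) = rep_mx f *m rep_mx g.
Proof.
elim/pathalg_ind: f => [|f1 f2 IH1 IH2|c q].
- by rewrite mul0r rep_mx0 mul0mx.
- by rewrite mulrDl rep_mxD rep_mxD IH1 IH2 mulmxDl.
elim/pathalg_ind: g => [|g1 g2 IH1 IH2|d p].
- by rewrite mulr0 rep_mx0 mulmx0.
- by rewrite mulrDr rep_mxD rep_mxD IH1 IH2 mulmxDr.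
have -> : (c *: pvec F q) * (d *: pvec F p) =
    if ptgt p == psrc q then (c * d) *: pvec F (psrc p, q.2 ++ p.2) else 0.
  exact: pathalg_mulUU.
rewrite !rep_mxU -scalemxAl -scalemxAr path_mxM scalerA -polyCM.
by case: ifP => _; rewrite ?rep_mxU // rep_mx0 scaler0.
Qed.

Lemma rep_mx1 : rep_mx 1 = 1%:M.
Proof.
have -> : 1 = pathalg_one F n by [].
rewrite pathalg_one.unlock (big_morph rep_mx rep_mxD rep_mx0).
rewrite (eq_bigr (fun i : 'Z_n => delta_mx i i)); last first.
  by move=> i _; rewrite rep_mx_pvec /path_mx /= scale1r.
by rewrite [RHS]mx1_sum_delta.
Qed.

Definition n_nonmem (j : 'Z_n) (a : nat) : nat :=
  \sum_(s < a) ((j + 1 + s%:R)%R \notin val I)%N.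
Definition n_mem (j : 'Z_n) (a : nat) : nat :=
  \sum_(s < a) ((j - s%:R)%R \in val I)%N.

Lemma ptgt_x (j : 'Z_n) a : ptgt ((j, nseq a true) : qpath n) = j + a%:R.
Proof.
rewrite /ptgt /=; elim: a => [|a IH] /=; first by rewrite addr0.
by rewrite IH -addrA natr1.
Qed.

Lemma ptgt_y (j : 'Z_n) a : ptgt ((j, nseq a false) : qpath n) = j - a%:R.
Proof.
rewrite /ptgt /=; elim: a => [|a IH] /=; first by rewrite subr0.
by rewrite IH -addrA -opprD natr1.
Qed.

Lemma word_coef_x j a : word_coef j (nseq a true) = 'X^(n_nonmem j a).
Proof.
rewrite /n_nonmem; elim: a => [|a IH] /=; first by rewrite big_ord0.
rewrite ptgt_x IH big_ord_recr /= addrAC.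
by case: (_ \in _); rewrite /= ?mul1r ?addn0 // addn1 exprS.
Qed.

Lemma word_coef_y j a : word_coef j (nseq a false) = 'X^(n_mem j a).
Proof.
rewrite /n_mem; elim: a => [|a IH] /=; first by rewrite big_ord0.
rewrite ptgt_y IH big_ord_recr /=.
by case: (_ \in _); rewrite /= ?mul1r ?addn0 // addn1 exprS.
Qed.

Let N_n : N = n. Proof. exact: Zp_cast. Qed.

Lemma Zn_natn : n%:R = 0 :> 'Z_n.
Proof. exact: pchar_Zp. Qed.

Lemma card_ksubset : #|val I| = k. Proof. exact/eqP/(valP I). Qed.

Lemma ksubset_le : (k <= n)%N.
Proof.
by rewrite -card_ksubset (leq_trans (max_card _)) // card_ord N_n.
Qed.

Lemma sum_Zn (G : nat -> nat) :
  (\sum_(0 <= s < n) G s = \sum_(i : 'Z_n) G i)%N.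
Proof. by rewrite big_mkord; move: (n) N_n G => m <-. Qed.

Lemma n_nonmem_mem j : n_nonmem j k = n_mem j (n - k).
Proof.
pose G (s : nat) : nat := (j + 1 + s%:R)%R \in val I.
have total : (\sum_(0 <= s < n) G s = k)%N.
  rewrite sum_Zn -[RHS]card_ksubset -sum1_card [RHS]big_mkcond /=.
  rewrite [RHS](reindex_inj (addrI (j + 1))) /=.
  by apply: eq_bigr => i _; rewrite /G natr_Zp; case: (_ \in _).
rewrite (big_cat_nat (leq0n k) ksubset_le) /= in total.
have E1 : (\sum_(0 <= s < k) G s + n_nonmem j k = k)%N.
  rewrite big_mkord /n_nonmem -big_split /= -[RHS]card_ord -sum1_card.
  by apply: eq_bigr => s _; rewrite /G; case: (_ \in _).
have E2 : (\sum_(k <= s < n) G s = n_mem j (n - k))%N.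
  rewrite /n_mem -{1}[k]add0n big_addn big_nat_rev /= big_mkord.
  apply: eq_bigr => s _; have le_sn : (s < n - k)%N := ltn_ord s.
  have -> : (0 + (n - k) - s.+1 + k = n - s.+1)%N.
    by have := ksubset_le; lia.
  rewrite /G natrB ?Zn_natn; last by rewrite (leq_trans le_sn) ?leq_subr.
  by rewrite add0r -natr1 opprD addrA addrAC addrK.
apply/eqP; rewrite -(eqn_add2l (\sum_(0 <= s < k) G s)%N).
by rewrite E1 -E2 total.
Qed.

Lemma rep_mx_relation f : B_relation k f -> rep_mx f = 0.
Proof.
case=> i [->|->]; rewrite rep_mxB !rep_mx_pvec.
  have E1 : path_mx (i, [:: true; false]) = 'X *: delta_mx i i.
    rewrite /path_mx /psrc; have -> : ptgt ((i, [:: true; false]) : qpath n) = i by exact: subrK.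
    have -> : word_coef i [:: true; false] = arrow_coef true (i - 1) * arrow_coef false i.
      by congr (_ * _); exact: mulr1.
    by rewrite /arrow_coef subrK; case: (i \in _); rewrite ?mulr1 ?mul1r.
  have E2 : path_mx (i, [:: false; true]) = 'X *: delta_mx i i.
    rewrite /path_mx /psrc; have -> : ptgt ((i, [:: false; true]) : qpath n) = i by exact: addrK.
    have -> : word_coef i [:: false; true] = arrow_coef false (i + 1) * arrow_coef true i.
      by congr (_ * _); exact: mulr1.
    by rewrite /arrow_coef; case: (i + 1 \in _); rewrite ?mulr1 ?mul1r.
  by rewrite E1 E2 subrr.
rewrite /path_mx ptgt_x ptgt_y word_coef_x word_coef_y n_nonmem_mem.
by rewrite natrB ?ksubset_le // Zn_natn sub0r opprK subrr.
Qed.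

Definition rep_kernel : ideal2 (pathalg F n).
Proof.
apply: (@Ideal2 _ (fun f => rep_mx f = 0)).
- exact: rep_mx0.
- by move=> f g f0 g0; rewrite rep_mxB f0 g0 subrr.
- by move=> f g g0; rewrite rep_mxM g0 mulmx0.
- by move=> f g f0; rewrite rep_mxM f0 mul0mx.
Defined.

Definition Brep_mx (b : B F n k) : 'M[{poly F}]_N := rep_mx (Brepr b).

Lemma Brep_mx_class f : Brep_mx (Bclass k f) = rep_mx f.
Proof.
apply/eqP; rewrite -subr_eq0 -rep_mxB; apply/eqP.
have /quot_classP : quot_class (ideal2_gen (B_relation k)) (Brepr (Bclass k f))
    = quot_class _ f by exact: quot_reprK.
by move/(_ rep_kernel); apply; exact: rep_mx_relation.
Qed.

Lemma Brep_mxD b c : Brep_mx (b + c) = Brep_mx b + Brep_mx c.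
Proof.
rewrite -[b]quot_reprK -[c]quot_reprK -quot_classD.
by rewrite !Brep_mx_class rep_mxD.
Qed.

Lemma Brep_mxM b c : Brep_mx (b * c) = Brep_mx b *m Brep_mx c.
Proof.
rewrite -[b]quot_reprK -[c]quot_reprK.
rewrite [_ * _](esym (quot_class_mul _ _ _)).
by rewrite !Brep_mx_class rep_mxM.
Qed.

Lemma Brep_mx1 : Brep_mx 1 = 1%:M.
Proof. by rewrite [1]/(Bclass k 1) Brep_mx_class rep_mx1. Qed.

Local Notation L := (rank1 F n_gt1 I).

Definition rank1_scale (b : B F n k) (v : L) : L := Brep_mx b *m v.

Lemma rank1_scaleA b c v : rank1_scale b (rank1_scale c v) = rank1_scale (b * c) v.
Proof. by rewrite /rank1_scale Brep_mxM mulmxA. Qed.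
Lemma rank1_scale1 : left_id 1 rank1_scale.
Proof. by move=> v; rewrite /rank1_scale Brep_mx1 mul1mx. Qed.
Lemma rank1_scaleDr : right_distributive rank1_scale +%R.
Proof. by move=> b v w; rewrite /rank1_scale mulmxDr. Qed.
Lemma rank1_scaleDl v : {morph rank1_scale^~ v : b c / b + c}.
Proof. by move=> b c; rewrite /rank1_scale Brep_mxD mulmxDl. Qed.

HB.instance Definition _ := GRing.Zmodule_isLmodule.Build (B F n k) L
  rank1_scaleA rank1_scale1 rank1_scaleDr rank1_scaleDl.

Definition rank1_one (i : 'Z_n) : L := delta_mx i 0.

End RankOne.

Section Combinatorics.
Variables (n k : nat) (I : ksubset n k).

Definition peaks : {set 'Z_n} :=
  [set u | (u \notin val I) && (u + 1 \in val I)].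
Definition valleys : {set 'Z_n} :=
  [set v | (v \in val I) && (v + 1 \notin val I)].

(* Distance from v to the nearest peak before, resp. after, v (v \in I). *)
Definition dist_prev (v : 'Z_n) : nat :=
  find (fun a => v - a%:R \in peaks) (iota 0 n).
Definition dist_next (v : 'Z_n) : nat :=
  find (fun a => v + a%:R \in peaks) (iota 0 n).

Definition prev_peak (v : 'Z_n) : 'Z_n := v - (dist_prev v)%:R.
Definition next_peak (v : 'Z_n) : 'Z_n := v + (dist_next v)%:R.

End Combinatorics.

Section Peaks.
Variables (n k : nat) (n_gt1 : (1 < n)%N) (I : ksubset n k).

Lemma Zn_natE (i : 'Z_n) : exists2 a, (a < n)%N & i = a%:R.
Proof.
exists (i : nat); last by rewrite natr_Zp.
by have := ltn_ord i; rewrite [X in (_ < X)%N](Zp_cast n_gt1).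
Qed.

Lemma has_peak v : v \in valleys I -> exists u, u \in peaks I.
Proof.
rewrite inE => /andP[vI vI'].
have exP : exists a, v - a%:R \notin val I.
  by have [a _ E] := Zn_natE (-1); exists a; rewrite -E opprK.
case: (ex_minnP exP) => -[|a] aP amin; first by rewrite subr0 vI in aP.
exists (v - a.+1%:R); rewrite inE aP /=.
have -> : v - a.+1%:R + 1 = v - a%:R by rewrite -natr1 opprD addrA subrK.
by apply/negPn/negP => /amin; rewrite ltnn.
Qed.

Lemma prev_peakP v : v \in valleys I -> prev_peak I v \in peaks I.
Proof.
case/has_peak => u uP; rewrite /prev_peak /dist_prev.
set P := fun a : nat => _.
have hasP : has P (iota 0 n).
  have [a lt_an E] := Zn_natE (v - u); apply/hasP; exists a.
    by rewrite mem_iota.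
  by rewrite /P -E opprB addrC subrK.
have := nth_find 0%N hasP; rewrite nth_iota ?add0n //.
by rewrite has_find size_iota in hasP.
Qed.

Lemma next_peakP v : v \in valleys I -> next_peak I v \in peaks I.
Proof.
case/has_peak => u uP; rewrite /next_peak /dist_next.
set P := fun a : nat => _.
have hasP : has P (iota 0 n).
  have [a lt_an E] := Zn_natE (u - v); apply/hasP; exists a.
    by rewrite mem_iota.
  by rewrite /P -E addrC subrK.
have := nth_find 0%N hasP; rewrite nth_iota ?add0n //.
by rewrite has_find size_iota in hasP.
Qed.

End Peaks.

Section Syzygies.
Variables (F : fieldType) (n k : nat) (n_gt1 : (1 < n)%N).

Local Notation B := (B F n k).
Local Notation L := (rank1 F n_gt1).

(* The direct sum of the projectives B e_s for s \in S, as the submodule of  *)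
(* families supported on S.                                                  *)
Definition sumP_car (S : {set 'Z_n}) (f : {ffun 'Z_n -> B^o}) : Prop :=
  forall s : 'Z_n,
    if s \in S then exists b : B, f s = b * idem F k s else f s = 0.

Lemma sumP_closed S : sumP_car S 0 /\
  forall (a : B) f g, sumP_car S f -> sumP_car S g -> sumP_car S (a *: f + g).
Proof.
split=> [s|a f g Sf Sg s].
  by case: ifP => _; rewrite ffunE //; exists 0; rewrite mul0r.
move: (Sf s) (Sg s); case: ifP => _ => [[b fs] [c gs]|fs gs]; rewrite !ffunE fs gs.
  by exists (a * b + c); rewrite mulrDl -mulrA.
by rewrite scaler0 addr0.
Qed.

Definition sumP_sub (S : {set 'Z_n}) : submodule {ffun 'Z_n -> B^o} :=
  Submodule (proj1 (sumP_closed S)) (proj2 (sumP_closed S)).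

Definition sumP (S : {set 'Z_n}) : lmodType B := submod_of (sumP_sub S).

Section Cover.
Variable I : ksubset n k.

Definition cover_fun (f : sumP (peaks I)) : L I :=
  \sum_(u in peaks I) (submod_val f u : B) *: (rank1_one F n_gt1 I u : L I).

Lemma cover_linear : linear cover_fun.
Proof.
move=> a f g; rewrite /cover_fun scaler_sumr -big_split.
by apply: eq_bigr => u _ /=; rewrite !ffunE scalerDl scalerA.
Qed.

HB.instance Definition _ :=
  GRing.isLinear.Build B (sumP (peaks I)) (L I) *:%R cover_fun cover_linear.

Definition cover : {linear sumP (peaks I) -> L I} := cover_fun.

Definition Omega1 : lmodType B := submod_of (ker cover).

(* The element b of B e_u, placed in the summand at u. *)
Definition inP (u : 'Z_n) (b : B) : {ffun 'Z_n -> B^o} :=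
  [ffun i => if i == u then b else 0].

(* The generator e_v goes to x^(v - u_-) - y^(u_+ - v): a path from u to v   *)
(* gives the map B e_v -> B e_u, b |-> b * path.                             *)
Definition syz_fun0 (g : sumP (valleys I)) : {ffun 'Z_n -> B^o} :=
  \sum_(v in valleys I)
    (inP (prev_peak I v) ((submod_val g v : B) *
        Bclass k (pvec F (xpath (prev_peak I v) (dist_prev I v))))
   - inP (next_peak I v) ((submod_val g v : B) *
        Bclass k (pvec F (ypath (next_peak I v) (dist_next I v))))).

Lemma inP_sumP u (b : B) (p : qpath n) : u \in peaks I -> psrc p = u ->
  sumP_sub (peaks I) (inP u (b * Bclass k (pvec F p))).
Proof.
move=> uP pu s; rewrite ffunE; case: eqP => [->|_]; last first.
  by case: ifP => // _; exists 0; rewrite mul0r.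
rewrite uP; exists (b * Bclass k (pvec F p)).
rewrite -mulrA; congr (_ * _); rewrite -[RHS](quot_class_mul _ _ _).
congr quot_class; rewrite -[X in X * _]scale1r -[X in _ * X]scale1r.
rewrite [RHS]pathalg_mulUU /ptgt /= -pu eqxx mulr1 scale1r cats0.
by case: p pu.
Qed.

Lemma syz_fun0P g : sumP_sub (peaks I) (syz_fun0 g).
Proof.
rewrite /syz_fun0; elim/big_ind: _ => [|f h Sf Sh|v vV].
- exact: submod0.
- by rewrite -[f]scale1r; exact: submodP.
rewrite addrC -scaleN1r; apply: submodP.
  by apply: inP_sumP => //; exact: next_peakP.
by apply: inP_sumP => //; exact: prev_peakP.
Qed.

Definition syz_fun (g : sumP (valleys I)) : sumP (peaks I) :=
  SubmodOf (asboolT (syz_fun0P g)).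

Lemma inPD u (b c : B) : inP u (b + c) = inP u b + inP u c.
Proof. by apply/ffunP=> i; rewrite !ffunE; case: eqP; rewrite ?addr0. Qed.

Lemma inPZ u (a b : B) : inP u (a * b) = a *: inP u b.
Proof. by apply/ffunP=> i; rewrite !ffunE; case: eqP; rewrite ?scaler0. Qed.

Lemma syz_fun0_linear : linear syz_fun0.
Proof.
move=> a f g; rewrite /syz_fun0 scaler_sumr -big_split.
apply: eq_bigr => v _ /=.
have E u (c : B) : inP u ((submod_val (a *: f + g) v : B) * c) =
    a *: inP u ((submod_val f v : B) * c) + inP u ((submod_val g v : B) * c).
  by rewrite !ffunE mulrDl -mulrA inPD inPZ.
by rewrite !E scalerBr opprD addrACA.
Qed.

Lemma syz_linear : linear syz_fun.
Proof. by move=> a f g; apply: val_inj; exact: syz_fun0_linear. Qed.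

HB.instance Definition _ :=
  GRing.isLinear.Build B (sumP (valleys I)) (sumP (peaks I)) *:%R
    syz_fun syz_linear.

Definition syz : {linear sumP (valleys I) -> sumP (peaks I)} := syz_fun.

Definition Omega2 : lmodType B := submod_of (ker syz).

End Cover.

(* M is isomorphic to the m-th syzygy of L_I, where the (m+2)-nd syzygy of   *)
(* L_I is the m-th syzygy of the module L_I' isomorphic to ker syz.          *)
Fixpoint is_syzygy (m : nat) (I : ksubset n k) (M : lmodType B) : Prop :=
  match m with
  | 0 => lmod_iso M (L I)
  | 1 => lmod_iso M (Omega1 I)
  | m'.+2 => exists I' : ksubset n k,
      lmod_iso (Omega2 I) (L I') /\ is_syzygy m' I' M
  end.

Definition is_period (I : ksubset n k) (m : nat) : Prop :=
  [/\ (0 < m)%N, is_syzygy m I (L I)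
    & forall m', (0 < m')%N -> is_syzygy m' I (L I) -> (m <= m')%N].

End Syzygies.

Section Intervals.
Variables (n k : nat) (I : ksubset n k).

Definition is_cyclic_interval (A : {set 'Z_n}) : bool :=
  [exists a : 'Z_n, exists d : 'I_n.+1,
    (0 < d)%N && (A == [set a + j%:R | j : 'I_d])].

Definition is_max_interval (A : {set 'Z_n}) : bool :=
  maxset (fun A' => is_cyclic_interval A' && (A' \subset val I)) A.

(* Travelling upwards from a, one meets z strictly before b. *)
Definition before (a z b : 'Z_n) : bool := (val (z - a)%R < val (b - a)%R)%N.

(* The A i are the maximal cyclic intervals of I, in cyclic order; they are  *)
(* nonempty, so the last clause does not depend on the points a, b, c.       *)
Definition interval_listing (r : nat) (A : 'I_r.+1 -> {set 'Z_n}) : Prop :=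
  [/\ injective A,
      forall S : {set 'Z_n}, is_max_interval S <-> exists i, S = A i
    & forall (i j : 'I_r.+1) (a b c : 'Z_n), (0 < i < j)%N ->
        a \in A ord0 -> b \in A i -> c \in A j -> before a b c].

Definition gap (A A' : {set 'Z_n}) : {set 'Z_n} :=
  [set z | (z \notin val I) &&
    [exists a in A, exists b in A', before a z b]].

Definition ivl_len r (A : 'I_r.+1 -> {set 'Z_n}) (i : 'I_r.+1) : nat := #|A i|.
Definition gap_len r (A : 'I_r.+1 -> {set 'Z_n}) (i : 'I_r.+1) : nat :=
  #|gap (A i) (A (ordS i))|.

(* Indices run over 0, ..., r, so that c here is c - 1 in the usual formula. *)
Definition period_half_candidate r (A : 'I_r.+1 -> {set 'Z_n}) (t : nat)
    : Prop :=
  (0 < t)%N /\ exists c : 'I_r.+1,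
    [/\ forall i, ivl_len A (c + i) = ivl_len A i,
        forall i, gap_len A (c + i) = gap_len A i
      & (k * t = \sum_(i < r.+1 | i < c) (ivl_len A i + gap_len A i)
          %[mod n])%N].

Definition is_least (P : nat -> Prop) (t : nat) : Prop :=
  P t /\ forall s : nat, P s -> (t <= s)%N.

End Intervals.

(* Main.v *)
From HB Require Import structures.
Require Import Defs.
From mathcomp Require Import all_boot all_order all_algebra.
From mathcomp Require Import boolp zify ring.

Set Implicit Arguments.
Unset Strict Implicit.
Unset Printing Implicit Defensive.

Import GRing.Theory.

(** Let t be the central element of B given by the sum of the xy.

Two parallel paths differ by a power of t, so every e_i B e_j is free over F[t]
on a single reduced path ([corner]).  This path acts on L_I as a power of X
times a matrix unit; hence B acts faithfully on L_I ([Brep_inj]), its centre is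
F[t] ([central_zpoly]), and each projective B e_v embeds into L_I by b |-> b
1_v.

Under these embeddings the equations of ker D say that the images in L_I of the
components at neighbouring valleys agree ([syz_eq0]).  So Omega^2(L_I) is the
intersection of the submodules B 1_v of L_I, for v a valley.  At the vertex i
it is generated by X^(depth i), where depth i is the number of elements of (i -
k, i] outside I: no reduced path ending at i has larger degree than the one
from i - k ([reduced_deg_le]), and one can walk from i - k to a valley without
losing degree ([depth_valley]).  As depth (i + 1) - depth i compares the
membership in I of i + 1 and of i + 1 - k, this submodule is L_(I + k)
([Omega2_iso]).

Therefore Omega^(2s)(L_I) is L_(I + ks) for every s.  Since L_I determines I
([rank1_iso_inj]), the even syzygies isomorphic to L_I are those with I + ks =
I. Such s are closed under subtraction and contain n / gcd(n, k), which the
least one thus divides.  No odd syzygy is isomorphic to L_I: it is the first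
syzygy of a translate of L_I, and with at least three peaks that module has two
elements at one vertex that are independent over F[t] ([Omega1_not_rank1]).

The number of peaks is r + 1 by the rank hypothesis.  Reading coordinates at
one vertex identifies the divisible submodules of the generic localization of
Omega(L_I) with the subspaces of the hyperplane of vectors with zero sum in
K^peaks, K being the fraction field of F[t]; a composition chain thus has
length the number of peaks minus one ([rank_peaks]).

Finally d_i + l_i is the distance between the starts of two consecutive maximal
intervals, so the sum over i < c of these numbers leads from the first start to
the c-th one.  The coincidence of the sequences d and l with their rotations by
c says precisely that I is invariant under the translation by this sum
([candidateP]). *)

(** * The ring B: reduced paths and the central element t *)

Section PathClasses.
Local Open Scope ring_scope.
Variables (F : fieldType) (n k : nat).

Local Notation B := (B F n k).
Local Notation cls f := (Bclass k (f : pathalg F n)).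
Local Notation tgt i w := (ptgt ((i, (w : seq bool)) : qpath n)).
Definition path_class (i : 'Z_n) (w : seq bool) : B := Bclass k (pvec F (i, w)).
Local Notation cl := path_class.

Lemma Bclass_M (f g : pathalg F n) : cls (f * g) = cls f * cls g.
Proof. exact: quot_class_mul. Qed.

Lemma Bclass_D (f g : pathalg F n) : cls (f + g) = cls f + cls g.
Proof. exact: quot_classD. Qed.

Lemma Bclass_0 : cls 0 = 0.
Proof. by apply: (addrI (cls 0)); rewrite -Bclass_D !addr0. Qed.

Lemma Bclass_rel (f g : pathalg F n) : B_relation k (f - g) -> cls f = cls g.
Proof. by move=> fg; apply/quot_classP => J; apply. Qed.

Lemma B_ind (P : B -> Prop) : P 0 -> (forall a b, P a -> P b -> P (a + b)) ->
  (forall (c : F) (i : 'Z_n) (w : seq bool), P (cls (c *: pvec F (i, w)))) ->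
    forall b, P b.
Proof.
move=> P0 PD PU b; rewrite -[b]quot_reprK -/(Bclass k _).
elim/pathalg_ind: (quot_repr b) => [|f g Pf Pg|c [i w]]; last exact: PU.
  by rewrite Bclass_0.
by rewrite Bclass_D; apply: PD.
Qed.

Lemma pathalg_scaleAl (c : F) (f g : pathalg F n) : (c *: f) * g = c *: (f * g).
Proof.
elim/pathalg_ind: f => [|f1 f2 IH1 IH2|d q].
- by rewrite scaler0 !mul0r scaler0.
- by rewrite scalerDr !mulrDl scalerDr IH1 IH2.
elim/pathalg_ind: g => [|g1 g2 IH1 IH2|e p].
- by rewrite !mulr0 scaler0.
- by rewrite !mulrDr scalerDr IH1 IH2.
rewrite scalerA.
rewrite (pathalg_mulUU _ q _ p : _ * _ = _) (pathalg_mulUU d q _ p : _ * _ = _).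
by case: ifP => _; rewrite ?scaler0 // scalerA mulrA.
Qed.

Lemma pathalg_scaleAr (c : F) (f g : pathalg F n) : f * (c *: g) = c *: (f * g).
Proof.
elim/pathalg_ind: f => [|f1 f2 IH1 IH2|d q].
- by rewrite !mul0r scaler0.
- by rewrite !mulrDl scalerDr IH1 IH2.
elim/pathalg_ind: g => [|g1 g2 IH1 IH2|e p].
- by rewrite scaler0 !mulr0 scaler0.
- by rewrite scalerDr !mulrDr scalerDr IH1 IH2.
rewrite scalerA.
rewrite (pathalg_mulUU _ q _ p : _ * _ = _) (pathalg_mulUU d q e p : _ * _ = _).
by case: ifP => _; rewrite ?scaler0 // scalerA mulrCA.
Qed.

Lemma clM (i j : 'Z_n) (v w : seq bool) :
  cl i v * cl j w = if tgt j w == i then cl j (v ++ w) else 0.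
Proof.
rewrite -Bclass_M -[X in cls (X * _)]scale1r -[X in cls (_ * X)]scale1r.
rewrite (pathalg_mulUU 1 (i, v) 1 (j, w) : _ * _ = _) mulr1 scale1r /psrc /=.
by case: eqP => // _; exact: Bclass_0.
Qed.

Lemma clM_eq (i j : 'Z_n) (v w : seq bool) :
  tgt j w = i -> cl i v * cl j w = cl j (v ++ w).
Proof. by move=> E; rewrite clM E eqxx. Qed.

Lemma idemE (i : 'Z_n) : idem F k i = cl i [::]. Proof. by []. Qed.

Lemma idem_cl (i j : 'Z_n) (w : seq bool) :
  idem F k i * cl j w = if tgt j w == i then cl j w else 0.
Proof. exact: clM. Qed.

Lemma cl_idem (i j : 'Z_n) (w : seq bool) : cl j w * idem F k i =
  if i == j then cl j w else 0.
Proof. by rewrite clM cats0; case: eqP => [<-|]. Qed.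

Lemma idemM (i j : 'Z_n) : idem F k i * idem F k j =
  if i == j then idem F k i else 0.
Proof. by rewrite cl_idem eq_sym; case: eqP => // ->. Qed.

Lemma idem_sum : \sum_(i : 'Z_n) idem F k i = 1.
Proof.
have -> : (1 : B) = cls (pathalg_one F n) by [].
by rewrite pathalg_one.unlock (big_morph (Bclass k) Bclass_D Bclass_0).
Qed.


Lemma cl_catl (i : 'Z_n) (u v w : seq bool) :
  tgt i v = tgt i w -> cl i v = cl i w ->
  cl i (u ++ v) = cl i (u ++ w).
Proof.
move=> Et E; rewrite -[LHS](@clM_eq _ i u v erefl).
by rewrite -[RHS](@clM_eq _ i u w erefl) E Et.
Qed.

Lemma cl_catr (i : 'Z_n) (u v w : seq bool) :
  cl (tgt i w) u = cl (tgt i w) v ->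
  cl i (u ++ w) = cl i (v ++ w).
Proof.
move=> E; rewrite -[LHS](@clM_eq _ i u w erefl).
by rewrite -[RHS](@clM_eq _ i v w erefl) E.
Qed.

Lemma cl_swap (i : 'Z_n) (v w : seq bool) :
  cl i (v ++ true :: false :: w) = cl i (v ++ false :: true :: w).
Proof.
apply: cl_catl.
  by rewrite /ptgt /= subrK addrK.
apply: (@cl_catr i [:: true; false] [:: false; true] w).
by apply: Bclass_rel; exists (tgt i w); left.
Qed.

Lemma ptgt_count (i : 'Z_n) (w : seq bool) :
  tgt i w = i + (count id w)%:R - (count negb w)%:R.
Proof.
elim: w => [|b w IH]; first by rewrite /ptgt /= addr0 subr0.
rewrite -cat1s ptgt_cat IH; case: b; rewrite /ptgt /= ?add0n ?add1n.
  by rewrite addrAC -natr1 addrA.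
by rewrite -natr1 opprD addrA.
Qed.

(** Commuting x past y sorts every word, so that the class of a path depends
only on its source and on its numbers of x and y. *)
Lemma cl_norm (i : 'Z_n) (w : seq bool) :
  cl i w = cl i (nseq (count id w) true ++ nseq (count negb w) false).
Proof.
elim: w => //= b w IH.
set w' := _ ++ _ in IH *.
have E : cl i (b :: w) = cl i (b :: w').
  apply: (@cl_catl i [:: b]) => //;
    rewrite !ptgt_count !count_cat !count_nseq /=.
  by rewrite !mul1n !mul0n addn0 add0n.
rewrite {}E; move: IH => _; rewrite {}/w'.
case: b => //; rewrite [(id _ + _)%N]add0n [(~~ false + _)%N]add1n.
elim: (count id w) => //= a IHa.
rewrite -(cl_swap i [::]); apply: (@cl_catl i [:: true]) => //.
by rewrite !ptgt_count; congr (_ + _%:R - _%:R); rewrite /= !count_cat /=; lia.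
Qed.

Lemma cl_perm (i : 'Z_n) (v w : seq bool) : perm_eq v w -> cl i v = cl i w.
Proof. by move=> /permP E; rewrite cl_norm [RHS]cl_norm !E. Qed.

Lemma cl_count (i : 'Z_n) (v w : seq bool) :
  count id v = count id w -> count negb v = count negb w -> cl i v = cl i w.
Proof. by move=> E1 E2; rewrite cl_norm [RHS]cl_norm E1 E2. Qed.

Lemma cl_xk (i : 'Z_n) : cl i (nseq k true) = cl i (nseq (n - k) false).
Proof. by apply: Bclass_rel; exists i; right. Qed.

Definition central_t : B := cls (\sum_(i : 'Z_n) pvec F (i, [:: true; false])).

Lemma central_tE : central_t = \sum_(i : 'Z_n) cl i [:: true; false].
Proof. exact: (big_morph (Bclass k) Bclass_D Bclass_0). Qed.

Lemma ptgt_tf (i : 'Z_n) : tgt i ([:: true; false]) = i.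
Proof. by rewrite /ptgt /= subrK. Qed.

Lemma central_t_cl (i : 'Z_n) (w : seq bool) : central_t * cl i w =
  cl i (true :: false :: w).
Proof.
rewrite central_tE mulr_suml (bigD1 (tgt i w)) //= clM_eq //.
by rewrite big1 ?addr0 // => j /negPf ne; rewrite clM eq_sym ne.
Qed.

Lemma cl_central_t (i : 'Z_n) (w : seq bool) : cl i w * central_t =
  cl i (true :: false :: w).
Proof.
rewrite central_tE mulr_sumr (bigD1 i) //= clM_eq ?ptgt_tf //.
rewrite big1 ?addr0 => [|j /negPf ne]; last by rewrite clM ptgt_tf ne.
by apply: cl_perm; rewrite perm_catC.
Qed.

Lemma central_tX_cl m (i : 'Z_n) (w : seq bool) :
  central_t ^+ m * cl i w = cl i (nseq m true ++ nseq m false ++ w).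
Proof.
elim: m => [|m IH]; first by rewrite expr0 mul1r.
rewrite exprS -mulrA IH central_t_cl; apply: cl_count;
  rewrite /= !(count_cat, count_nseq) /= ?count_cat ?count_nseq; lia.
Qed.

Definition scalar_class (c : F) : B := cls (c *: (1 : pathalg F n)).

Lemma scalar_class_cls (c : F) f : scalar_class c * cls f = cls (c *: f).
Proof. by rewrite -Bclass_M pathalg_scaleAl mul1r. Qed.

Lemma cls_scalar_class (c : F) f : cls f * scalar_class c = cls (c *: f).
Proof. by rewrite -Bclass_M pathalg_scaleAr mulr1. Qed.

Lemma scalar_classD c d : scalar_class (c + d) =
  scalar_class c + scalar_class d.
Proof. by rewrite /scalar_class scalerDl Bclass_D. Qed.

Lemma scalar_class0 : scalar_class 0 = 0.
Proof. by rewrite /scalar_class scale0r Bclass_0. Qed.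

Lemma scalar_class1 : scalar_class 1 = 1.
Proof. by rewrite /scalar_class scale1r. Qed.

Lemma scalar_class_central c : central (scalar_class c).
Proof.
move=> b; rewrite -[b]quot_reprK -/(Bclass k _).
exact: etrans (scalar_class_cls _ _) (esym (cls_scalar_class _ _)).
Qed.

Lemma central_t_central : central central_t.
Proof.
move=> b; elim/B_ind: b => [|a b Ea Eb|c i w].
- by rewrite mulr0 mul0r.
- by rewrite mulrDr mulrDl Ea Eb.
by rewrite -scalar_class_cls mulrA -(scalar_class_central c central_t) -!mulrA
  central_t_cl cl_central_t.
Qed.

Lemma centralD (a b : B) : central a -> central b -> central (a + b).
Proof. by move=> ca cb c; rewrite mulrDl mulrDr ca cb. Qed.

Lemma centralM (a b : B) : central a -> central b -> central (a * b).
Proof. by move=> ca cb c; rewrite -mulrA cb mulrA ca mulrA. Qed.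

Lemma centralX (a : B) m : central a -> central (a ^+ m).
Proof.
move=> ca; elim: m => [b|m IH]; first by rewrite expr0 mul1r mulr1.
by rewrite exprS; exact: centralM.
Qed.

(** The element q(t) of the centre. *)
Definition zpoly (q : {poly F}) : B :=
  \sum_(m < size q) scalar_class q`_m * central_t ^+ m.

Lemma zpolyEw N (q : {poly F}) : (size q <= N)%N ->
  zpoly q = \sum_(m < N) scalar_class q`_m * central_t ^+ m.
Proof.
move=> le; rewrite /zpoly (big_ord_widen _ (fun m =>
  scalar_class q`_m * central_t ^+ m) le).
rewrite big_mkcond /=; apply: eq_bigr => m _; case: ltnP => // le2.
by rewrite nth_default // scalar_class0 mul0r.
Qed.

Lemma zpolyD (p q : {poly F}) : zpoly (p + q) = zpoly p + zpoly q.
Proof.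
pose N := maxn (size p) (size q).
rewrite !(@zpolyEw N) ?size_polyD ?leq_maxl ?leq_maxr //.
by rewrite -big_split; apply: eq_bigr => m _;
  rewrite coefD scalar_classD mulrDl.
Qed.

Lemma zpoly0 : zpoly 0 = 0.
Proof. by rewrite /zpoly size_poly0 big_ord0. Qed.

Lemma zpolyMXn c m : zpoly (c *: 'X^m) = scalar_class c * central_t ^+ m.
Proof.
rewrite (@zpolyEw m.+1); last first.
  by rewrite (leq_trans (size_scale_leq _ _)) // size_polyXn.
rewrite big_ord_recr big1 /= => [|j _]; rewrite coefZ coefXn.
  by rewrite eqxx mulr1 add0r.
by rewrite ltn_eqF ?ltn_ord // mulr0 scalar_class0 mul0r.
Qed.

Lemma zpoly1 : zpoly 1 = 1.
Proof. by rewrite -[1]scale1r -(expr0 'X) zpolyMXn scalar_class1 mul1r expr0.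
  Qed.

Lemma zpoly_central q : central (zpoly q).
Proof.
rewrite /zpoly; elim/big_ind: _ => [b||m _]; first by rewrite mul0r mulr0.
  exact: centralD.
by apply: centralM; [exact: scalar_class_central | apply: centralX;
  exact: central_t_central].
Qed.

Hypotheses (n_gt1 : (1 < n)%N) (k_ltn : (k < n)%N).

(** By x^k = y^(n-k), every vertex is reached by at most k letters x or by
fewer than n - k letters y. *)
Definition reduced_word (j i : 'Z_n) : seq bool :=
  let a := val (i - j) in
  if (a <= k)%N then nseq a true else nseq (n - a) false.

Lemma val_Zn a : (a < n)%N -> val (a%:R : 'Z_n) = a.
Proof. by move=> lt; rewrite /= val_Zp_nat // modn_small. Qed.

Lemma reduced_word_x (j : 'Z_n) a : (a <= k)%N ->
  reduced_word j (j + a%:R) = nseq a true.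
Proof. by move=> le; rewrite /reduced_word addrC addKr val_Zn ?le //; lia. Qed.

Lemma reduced_word_y (j : 'Z_n) b : (b < n - k)%N ->
  reduced_word j (j - b%:R) = nseq b false.
Proof.
case: b => [_|b lt].
  by rewrite subr0 -[X in reduced_word _ X]addr0 (@reduced_word_x _ 0).
have -> : - (b.+1)%:R = (n - b.+1)%:R :> 'Z_n.
  by rewrite natrB ?pchar_Zp ?sub0r //; lia.
rewrite /reduced_word addrC addKr val_Zn; last lia.
by case: leqP => ?; [lia | congr nseq; lia].
Qed.

Lemma ptgt_reduced_word (j i : 'Z_n) : tgt j (reduced_word j i) = i.
Proof.
have lt : (val (i - j)%R < n)%N.
  by have := ltn_ord (i - j); rewrite [X in (_ < X)%N](Zp_cast n_gt1).
have E : (val (i - j))%:R = i - j :> 'Z_n by exact: natr_Zp.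
rewrite /reduced_word ptgt_count; move: (val (i - j)) E lt => a E lt.
case: leqP => _; rewrite !count_nseq /= ?mul1n ?mul0n.
  by rewrite subr0 E addrC subrK.
by rewrite addr0 natrB ?pchar_Zp ?sub0r ?opprK ?E 1?addrC ?subrK // ltnW.
Qed.

Lemma cl_cat_xk (j : 'Z_n) (w : seq bool) :
  cl j (w ++ nseq k true) = cl j (w ++ nseq (n - k) false).
Proof.
apply: cl_catl; last exact: cl_xk.
rewrite !ptgt_count !count_nseq /= !mul1n !mul0n subr0 addr0.
by rewrite natrB ?pchar_Zp ?sub0r ?opprK // ltnW.
Qed.

Lemma central_t_factor (j : 'Z_n) (v w : seq bool) (m : nat) :
  count id v = (m + count id w)%N -> count negb v = (m + count negb w)%N ->
  cl j v = central_t ^+ m * cl j w.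
Proof.
move=> E1 E2; rewrite central_tX_cl; apply: cl_count;
  rewrite !count_cat !count_nseq /= ?E1 ?E2; lia.
Qed.

(** Once a > k, replacing x^k by y^(n-k) creates letters y, which pair off
with the remaining letters x into powers of t; what is left is shorter or
reduced. *)
Lemma cl_red_x (j : 'Z_n) a :
  exists m : nat, cl j (nseq a true) =
    central_t ^+ m * cl j (reduced_word j (j + a%:R)).
Proof.
elim/ltn_ind: a => a IH; case: (leqP a k) => le.
  by exists 0%N; rewrite expr0 mul1r reduced_word_x.
have -> : cl j (nseq a true) = cl j (nseq (a - k) true ++ nseq (n - k) false).
  by rewrite -cl_cat_xk; apply: cl_count; rewrite ?(count_cat, count_nseq) /=;
    lia.
case: (leqP n a) => le2.
  have [m E] : exists m, cl j (nseq (a - n) true)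
       = central_t ^+ m * cl j (reduced_word j (j + a%:R)).
    have [m E] := IH (a - n)%N ltac:(lia); exists m.
    by rewrite E natrB // pchar_Zp // subr0.
  exists (n - k + m)%N; rewrite exprD -mulrA -E; apply: central_t_factor;
    rewrite ?(count_cat, count_nseq) /=; lia.
exists (a - k)%N.
have -> : a%:R = - (n - a)%:R :> 'Z_n.
  by rewrite natrB ?pchar_Zp ?sub0r ?opprK //; lia.
rewrite reduced_word_y; last lia.
by apply: central_t_factor; rewrite ?(count_cat, count_nseq) /=; lia.
Qed.

(** Symmetric to [cl_red_x], replacing y^(n-k) by x^k. *)
Lemma cl_red_y (j : 'Z_n) b :
  exists m : nat, cl j (nseq b false) =
    central_t ^+ m * cl j (reduced_word j (j - b%:R)).
Proof.
elim/ltn_ind: b => b IH; case: (ltnP b (n - k)) => le.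
  by exists 0%N; rewrite expr0 mul1r reduced_word_y.
have -> : cl j (nseq b false) = cl j (nseq (b - (n - k)) false ++ nseq k true).
  by rewrite cl_cat_xk; apply: cl_count; rewrite ?(count_cat, count_nseq) /=;
    lia.
case: (leqP n b) => le2.
  have [m E] : exists m, cl j (nseq (b - n) false)
       = central_t ^+ m * cl j (reduced_word j (j - b%:R)).
    have [m E] := IH (b - n)%N ltac:(lia); exists m.
    by rewrite E natrB // pchar_Zp // subr0.
  exists (k + m)%N; rewrite exprD -mulrA -E; apply: central_t_factor;
    rewrite ?(count_cat, count_nseq) /=; lia.
exists (b - (n - k))%N.
have -> : - b%:R = (n - b)%:R :> 'Z_n.
  by rewrite natrB ?pchar_Zp ?sub0r //; lia.
rewrite reduced_word_x; last lia.
by apply: central_t_factor; rewrite ?(count_cat, count_nseq) /=; lia.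
Qed.

Lemma cl_red (j : 'Z_n) (w : seq bool) : exists m : nat,
  cl j w = central_t ^+ m * cl j (reduced_word j (tgt j w)).
Proof.
rewrite ptgt_count; set a := count id w; set b := count negb w.
case: (leqP b a) => le.
  have [m E] := cl_red_x j (a - b); exists (b + m)%N.
  rewrite exprD -mulrA (_ : j + _ - _ = j + (a - b)%:R) ?natrB ?addrA //.
  by rewrite -addrA -natrB // -E; apply: central_t_factor;
    rewrite !count_nseq /=; lia.
have [m E] := cl_red_y j (b - a); exists (a + m)%N.
rewrite exprD -mulrA (_ : j + _ - _ = j - (b - a)%:R); last first.
  by rewrite natrB ?opprB ?addrA // ltnW.
by rewrite -E; apply: central_t_factor; rewrite !count_nseq /=; lia.
Qed.

Definition reduced_path (j i : 'Z_n) : B := cl j (reduced_word j i).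

Lemma reduced_path_id (l : 'Z_n) : reduced_path l l = idem F k l.
Proof.
by rewrite /reduced_path -[X in reduced_word l X]addr0 (@reduced_word_x l 0).
Qed.

(** All paths from j to i are multiples of the reduced one by powers of t
([cl_red]). *)
Lemma corner (i j : 'Z_n) (b : B) : exists q : {poly F},
  idem F k i * b * idem F k j = zpoly q * reduced_path j i.
Proof.
elim/B_ind: b => [|a b [p Ea] [q Eb]|c l w].
- by exists 0; rewrite mulr0 mul0r zpoly0 mul0r.
- by exists (p + q); rewrite mulrDr mulrDl Ea Eb zpolyD mulrDl.
rewrite -scalar_class_cls mulrA -(scalar_class_central c) -!mulrA cl_idem.
case: eqP => [<-|_]; last by exists 0; rewrite !mulr0 zpoly0 mul0r.
rewrite idem_cl; case: eqP => [<-|_]; last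
  by exists 0; rewrite !mulr0 zpoly0 mul0r.
have [m ->] := cl_red j w; exists (c *: 'X^m).
by rewrite zpolyMXn -mulrA.
Qed.

Lemma corner_sum (b : B) j :
  b * idem F k j = \sum_(i : 'Z_n) idem F k i * b * idem F k j.
Proof. by rewrite -!mulr_suml idem_sum mul1r. Qed.

End PathClasses.

(** * Faithfulness of the rank one representations and the centre *)

Section Faithful.
Local Open Scope ring_scope.
Variables (F : fieldType) (n k : nat) (n_gt1 : (1 < n)%N).
Variable I : ksubset n k.

Local Notation B := (B F n k).
Local Notation cl := (@path_class F n k).
Local Notation tgt i w := (ptgt ((i, (w : seq bool)) : qpath n)).
Local Notation rho := (@Brep_mx F n k I).
Local Notation zpoly := (@zpoly F n k).
Local Notation e := (@idem F n k).

Lemma Brep_mx0 : rho 0 = 0.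
Proof. by apply: (addrI (rho 0)); rewrite -Brep_mxD // !addr0. Qed.

Lemma Brep_mxN b : rho (- b) = - rho b.
Proof.
by apply/eqP; rewrite -subr_eq0 opprK -Brep_mxD // addNr Brep_mx0.
Qed.

Lemma Brep_mxB b c : rho (b - c) = rho b - rho c.
Proof. by rewrite Brep_mxD // Brep_mxN. Qed.

Lemma Brep_mx_sum J (r : seq J) (P : pred J) (f : J -> B) :
  rho (\sum_(i <- r | P i) f i) = \sum_(i <- r | P i) rho (f i).
Proof. exact: (big_morph rho (@Brep_mxD _ _ _ n_gt1 I) Brep_mx0). Qed.

Lemma Brep_path_class j w : rho (cl j w) =
  word_coef F I j w *: delta_mx (tgt j w) j.
Proof. by rewrite (Brep_mx_class n_gt1) rep_mx_pvec. Qed.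

Lemma Brep_idem i : rho (e i) = delta_mx i i.
Proof. by rewrite idemE Brep_path_class scale1r. Qed.

Lemma Brep_scalar_class c : rho (scalar_class n k c) = (c%:P)%:M.
Proof.
rewrite (Brep_mx_class n_gt1).
have -> : (1 : pathalg F n) = pathalg_one F n by [].
rewrite pathalg_one.unlock scaler_sumr.
rewrite (big_morph (rep_mx I) (@rep_mxD _ _ _ I) (rep_mx0 F I)).
rewrite (eq_bigr (fun i => c%:P *: delta_mx i i)) => [|i _]; last first.
  by rewrite rep_mxU /path_mx /= scale1r.
by rewrite -scaler_sumr -mx1_sum_delta scalemx1.
Qed.

Lemma arrow_pair i : arrow_coef F I true i * arrow_coef F I false (i + 1) = 'X.
Proof. by rewrite /arrow_coef; case: (_ \in _); rewrite ?mul1r ?mulr1. Qed.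

Lemma Brep_central_t : rho (central_t F n k) = 'X%:M.
Proof.
rewrite central_tE Brep_mx_sum.
rewrite (eq_bigr (fun i => 'X *: delta_mx i i)) => [|i _]; last first.
  rewrite Brep_path_class ptgt_tf; congr (_ *: _).
  by rewrite -(arrow_pair (i - 1)) subrK -[RHS]mulr1 -mulrA.
by rewrite -scaler_sumr -mx1_sum_delta scalemx1.
Qed.

Lemma Brep_central_tX m : rho (central_t F n k ^+ m) = ('X ^+ m)%:M.
Proof.
elim: m => [|m IH]; first by rewrite !expr0 (Brep_mx1 _ n_gt1).
by rewrite !exprS (Brep_mxM n_gt1) IH Brep_central_t -scalar_mxM.
Qed.

Lemma Brep_zpoly q : rho (zpoly q) = q%:M.
Proof.
rewrite /zpoly Brep_mx_sum.
under eq_bigr => i _ do rewrite (Brep_mxM n_gt1) Brep_central_tX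
  Brep_scalar_class -scalar_mxM mul_polyC.
by rewrite -raddf_sum -[X in _ = X%:M]coefK poly_def.
Qed.

Hypothesis k_ltn : (k < n)%N.

(** The exponent of X by which the reduced path from j to i acts on L_I. *)
Definition reduced_deg (j i : 'Z_n) : nat :=
  let a := val (i - j) in
  if (a <= k)%N then n_nonmem I j a else n_mem I j (n - a).

Lemma word_coef_reduced_word j i : word_coef F I j (reduced_word k j i) =
  'X^(reduced_deg j i).
Proof.
by rewrite /reduced_word /reduced_deg; case: ifP => _;
  rewrite (word_coef_x, word_coef_y).
Qed.

Lemma Brep_reduced_path q j i :
  rho (zpoly q * reduced_path F k j i) =
    (q * 'X^(reduced_deg j i)) *: delta_mx i j.
Proof.
rewrite (Brep_mxM n_gt1) Brep_zpoly Brep_path_class word_coef_reduced_word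
  ptgt_reduced_word //.
by rewrite mul_scalar_mx scalerA.
Qed.

Lemma Brep_corner i b j : rho (e i * b * e j) = rho b i j *: delta_mx i j.
Proof.
rewrite !(Brep_mxM n_gt1) !Brep_idem; apply/matrixP => a c.
rewrite !mxE (bigD1 j) //= big1 => [|l /negPf lj]; last first.
  by rewrite !mxE lj mulr0.
rewrite !mxE (bigD1 i) //= big1 => [|l /negPf li]; last first.
  by rewrite !mxE li andbF mul0r.
rewrite !mxE !eqxx andbT !addr0.
by case: (a == i); case: (c == j); rewrite ?(mul0r, mulr0, mul1r, mulr1).
Qed.

(** Makes the coefficient of the reduced path readable from a matrix entry; as
X is not a zero divisor, a corner of B is determined by its entry. *)
Lemma corner_rho i b j : exists q : {poly F},
  e i * b * e j = zpoly q * reduced_path F k j i /\ rho b i j =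
    q * 'X^(reduced_deg j i).
Proof.
have [q E] := corner n_gt1 k_ltn i j b; exists q; split=> //.
have /matrixP /(_ i j) := congr1 rho E.
by rewrite Brep_corner Brep_reduced_path !mxE !eqxx !mulr1.
Qed.

Lemma Brep_col_inj b j : (forall i, rho b i j = 0) -> b * e j = 0.
Proof.
move=> b0; rewrite corner_sum big1 // => i _.
have [q [-> E]] := corner_rho i b j; move: E; rewrite b0 => /esym/eqP.
by rewrite mulf_eq0 expf_eq0 polyX_eq0 andbF orbF => /eqP ->;
  rewrite zpoly0 mul0r.
Qed.

Lemma Brep_inj : injective rho.
Proof.
move=> b c E; apply/eqP; rewrite -subr_eq0 -[b - c]mulr1 -idem_sum mulr_sumr.
rewrite big1 // => j _; apply: Brep_col_inj => i.
by rewrite Brep_mxB E subrr mxE.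
Qed.

Lemma arrow_neq0 b j : arrow_coef F I b j != 0.
Proof.
by rewrite /arrow_coef; case: b; case: (_ \in _); rewrite ?oner_neq0 ?polyX_eq0.
Qed.

Lemma word_coef_neq0 j w : word_coef F I j w != 0.
Proof.
elim: w => [|b w IH] /=; first exact: oner_neq0.
by rewrite mulf_neq0 ?arrow_neq0.
Qed.

(** A matrix commuting with the idempotents is diagonal, and commuting with
the arrows x forces its diagonal to be constant; faithfulness lifts the scalar
to B. *)
Lemma central_zpoly (z : B) : central z -> exists q, z = zpoly q.
Proof.
move=> cz.
have D i j : i != j -> rho z i j = 0.
  move=> ne; have /matrixP /(_ i j) := congr1 rho (cz (e j)).
  rewrite !(Brep_mxM n_gt1) Brep_idem !mxE (bigD1 j) //= big1 =>
    [|l /negPf lj]; last first.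
    by rewrite !mxE lj mulr0.
  rewrite big1 => [|l _]; last by rewrite !mxE (negPf ne) mul0r.
  by rewrite !mxE !eqxx mulr1 addr0.
have E i : rho z (i + 1) (i + 1) = rho z i i.
  have /matrixP /(_ (i + 1) i) := congr1 rho (cz (cl i [:: true])).
  rewrite !(Brep_mxM n_gt1) Brep_path_class [tgt _ _]/(i + 1) !mxE.
  rewrite (bigD1 (i + 1)) //= big1 => [|l /negPf lj]; last first.
    by rewrite !mxE lj /= !mulr0.
  rewrite (bigD1 i) //= big1 => [|l /negPf lj]; last first.
    by rewrite !mxE lj andbF mulr0 mul0r.
  rewrite !mxE !eqxx !mulr1 !addr0 mulrC; apply: mulfI;
    exact: (arrow_neq0 true i).
exists (rho z 0 0); apply: Brep_inj; rewrite Brep_zpoly.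
apply/matrixP => i j; rewrite !mxE; case: eqP => [<-|/eqP /D ->] //.
rewrite mulr1n -[i]natr_Zp; elim: (i : nat) => [|m <-] //.
by rewrite -natr1.
Qed.

Lemma zpoly_eq0 q : zpoly q = 0 -> q = 0.
Proof.
move=> /(congr1 rho); rewrite Brep_zpoly Brep_mx0 => /matrixP /(_ 0 0).
by rewrite !mxE eqxx.
Qed.

End Faithful.

(** * Degrees of reduced paths *)

Section Degrees.
Local Open Scope ring_scope.
Variables (n k : nat) (n_gt1 : (1 < n)%N).
Variable I : ksubset n k.

(** The degree of the reduced path from i - k to i. Both x^k and y^(n-k) lead
from i - k to i, so that the degree also counts the elements of I in (i, i -
k] ([depthE']). *)
Definition depth (i : 'Z_n) : nat := n_nonmem I (i - k%:R) k.

Lemma n_nonmemE (i : 'Z_n) a :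
  n_nonmem I (i - a%:R) a = (\sum_(0 <= s < a) ((i - s%:R)%R \notin val I))%N.
Proof.
rewrite /n_nonmem -(big_mkord xpredT (fun s =>
  nat_of_bool (i - a%:R + 1 + s%:R \notin val I))).
rewrite big_nat_rev /=. apply: eq_big_nat => s /andP[_ lt].
by congr (nat_of_bool (_ \notin val I)); rewrite add0n natrB // -natr1; ring.
Qed.

Lemma n_memE (i : 'Z_n) a :
  n_mem I (i + a%:R) a = (\sum_(0 <= s < a) ((i + 1 + s%:R)%R \in val I))%N.
Proof.
rewrite /n_mem -(big_mkord xpredT (fun s =>
  nat_of_bool (i + a%:R - s%:R \in val I))).
rewrite big_nat_rev /=; apply: eq_big_nat => s /andP[_ lt].
by congr (nat_of_bool (_ \in val I)); rewrite add0n natrB // -natr1; ring.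
Qed.

Lemma depthE i : depth i = (\sum_(0 <= s < k) ((i - s%:R)%R \notin val I))%N.
Proof. exact: n_nonmemE. Qed.

Lemma subk_add (i : 'Z_n) : (k <= n)%N -> i - k%:R = i + (n - k)%:R.
Proof. by move=> le; rewrite natrB // pchar_Zp // sub0r. Qed.

Lemma depthE' i : depth i =
  (\sum_(0 <= s < n - k) ((i + 1 + s%:R)%R \in val I))%N.
Proof.
by rewrite /depth n_nonmem_mem // subk_add ?n_memE // (ksubset_le n_gt1 I).
Qed.

(** The window (i - k, i] gains i + 1 and loses i + 1 - k. *)
Lemma depth_step i :
  (depth (i + 1)%R + ((i + 1 - k%:R)%R \notin val I) =
   depth i + ((i + 1)%R \notin val I))%N.
Proof.
rewrite !depthE.
rewrite -(big_nat_recr k 0 (fun s =>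
  nat_of_bool (i + 1 - s%:R \notin val I))) //.
rewrite big_nat_recl // subr0 addnC; congr (_ + _)%N.
by apply: eq_bigr => s _; rewrite -natr1 opprD [- _ - 1]addrC addrA addrK.
Qed.

Hypothesis k_ltn : (k < n)%N.

(** A reduced path ending at i is a final piece of one of the two paths x^k
and y^(n-k) from i - k to i. *)
Lemma reduced_deg_le (j i : 'Z_n) : (reduced_deg I j i <= depth i)%N.
Proof.
have Ej : j = i - (val (i - j))%:R by rewrite natr_Zp opprB addrC subrK.
have lt : (val (i - j)%R < n)%N
  by have := ltn_ord (i - j); rewrite [X in (_ < X)%N](Zp_cast n_gt1).
rewrite /reduced_deg; move: (val (i - j)) Ej lt => a -> lt;
  case: (leqP a k) => le.
  by rewrite n_nonmemE depthE (big_cat_nat (leq0n a) le) leq_addr.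
have -> : i - a%:R = i + (n - a)%:R by rewrite natrB ?pchar_Zp ?sub0r // ltnW.
have le2 : (n - a <= n - k)%N by lia.
by rewrite n_memE depthE' (big_cat_nat (leq0n (n - a)) le2) leq_addr.
Qed.

Lemma ex_nonmem : exists i : 'Z_n, i \notin val I.
Proof.
apply/existsP; rewrite -negb_forall; apply/negP => /forallP all.
have := card_ksubset I; have /setP : val I = [set: 'Z_n].
  by apply/setP => i; rewrite all inE.
move/setP=> -> ; rewrite cardsT card_ord => E.
by have := Zp_cast n_gt1; lia.
Qed.

Hypothesis k_gt0 : (0 < k)%N.

Lemma ex_mem : exists i : 'Z_n, i \in val I.
Proof.
apply/set0Pn; rewrite -card_gt0 (card_ksubset I) //.
Qed.

Lemma find_up (P : pred 'Z_n) (i : 'Z_n) : (exists j, P j) ->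
  exists a, P (i + a%:R) /\ forall b, (b < a)%N -> ~~ P (i + b%:R).
Proof.
case=> j Pj; have ex : exists a, P (i + a%:R).
  by exists (val (j - i)); rewrite natr_Zp addrC subrK.
case: (ex_minnP ex) => a Pa amin; exists a; split=> // b lt.
by apply/negP => /amin; rewrite leqNgt lt.
Qed.

Lemma find_down (P : pred 'Z_n) (i : 'Z_n) : (exists j, P j) ->
  exists a, P (i - a%:R) /\ forall b, (b < a)%N -> ~~ P (i - b%:R).
Proof.
case=> j Pj; have ex : exists a, P (i - a%:R).
  by exists (val (i - j)); rewrite natr_Zp opprB addrC subrK.
case: (ex_minnP ex) => a Pa amin; exists a; split=> // b lt.
by apply/negP => /amin; rewrite leqNgt lt.
Qed.

Lemma reduced_deg_x (i : 'Z_n) a : (a <= k)%N ->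
  reduced_deg I (i - a%:R) i =
    (\sum_(0 <= s < a) ((i - s%:R)%R \notin val I))%N.
Proof.
move=> le; rewrite /reduced_deg opprB addrC subrK val_Zn ?le ?n_nonmemE //; lia.
Qed.

Lemma reduced_deg_y (i : 'Z_n) a : (0 < a < n - k)%N ->
  reduced_deg I (i + a%:R) i =
    (\sum_(0 <= s < a) ((i + 1 + s%:R)%R \in val I))%N.
Proof.
move=> lt; have -> : reduced_deg I (i + a%:R) i = n_mem I (i + a%:R) a;
  last exact: n_memE.
have E : i - (i + a%:R) = (n - a)%:R :> 'Z_n.
  by rewrite opprD addNKr natrB ?pchar_Zp ?sub0r //; lia.
rewrite /reduced_deg E val_Zn //; last lia.
by case: leqP => ?; [lia|congr n_mem; lia].
Qed.

(** If i - k lies in I, walking up inside I removes arrows x of degree 0 from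
the path to i and stops at a valley; otherwise walking down outside I removes
arrows y of degree 0. *)
Lemma depth_valley i : exists2 v, v \in valleys I & reduced_deg I v i = depth i.
Proof.
case: (boolP (i - k%:R \in val I)) => ik.
  have [a [Pa amin]] := find_up (i - k%:R + 1) ex_nonmem.
  have mem b : (b <= a)%N -> i - k%:R + b%:R \in val I.
    case: b => [_|b lt]; first by rewrite addr0.
    by have := amin b lt; rewrite -addrA nat1r negbK.
  exists (i - k%:R + a%:R).
    by rewrite inE mem //= addrAC.
  have M0 : depth i = (\sum_(0 <= s < k - a) ((i - s%:R)%R \notin val I))%N.
    rewrite depthE (big_cat_nat (leq0n (k - a)) (leq_subr _ _)) /=.
    rewrite [X in (_ + X)%N]big_nat_cond [X in (_ + X)%N]big1 ?addn0 // => s.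
    rewrite andbT => /andP[le lt].
    have -> : i - s%:R = i - k%:R + (k - s)%:R.
      by rewrite natrB 1?ltnW // addrA subrK.
    by rewrite mem //; lia.
  apply/eqP; rewrite eqn_leq reduced_deg_le /=.
  (* If a > k, all of (i - k, i] lies in I and the depth is 0. *)
  case: (leqP a k) => le; last first.
    have -> : depth i = 0%N by rewrite M0 big_geq //; lia.
    by [].
  have -> : i - k%:R + a%:R = i - (k - a)%:R
    by rewrite natrB // opprB addrA addrAC.
  by rewrite reduced_deg_x ?leq_subr // M0.
have [a [Pa amin]] := find_down (i - k%:R) ex_mem.
have a0 : (0 < a)%N by case: a Pa {amin} => // ; rewrite subr0 (negPf ik).
exists (i - k%:R - a%:R).
  rewrite inE Pa /= -(prednK a0) -natr1 opprD addrA subrK.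
  by apply: amin; lia.
apply/eqP; rewrite eqn_leq reduced_deg_le /=.
have M0 : depth i = (\sum_(0 <= s < n - k - a) ((i + 1 + s%:R)%R \in val I))%N.
  rewrite depthE' (big_cat_nat (leq0n (n - k - a)) (leq_subr _ _)) /=.
  rewrite [X in (_ + X)%N]big_nat_cond [X in (_ + X)%N]big1 ?addn0 // => s.
  rewrite andbT => /andP[le lt].
  have -> : i + 1 + s%:R = i - k%:R - (n - k - s.+1)%:R.
    by rewrite (subk_add _ (ltnW k_ltn)) (natrB _ lt) -natr1; ring.
  by rewrite (negPf (amin _ _)) //; lia.
case: (ltnP a (n - k)) => le; last by rewrite M0 big_geq //; lia.
have -> : i - k%:R - a%:R = i + (n - k - a)%:R.
  by rewrite (subk_add _ (ltnW k_ltn)) (natrB _ (ltnW le)) addrA.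
by rewrite reduced_deg_y ?M0 //; lia.
Qed.

End Degrees.

(** * Peaks and valleys *)

Section PeaksValleys.
Local Open Scope ring_scope.
Variables (n k : nat) (n_gt1 : (1 < n)%N).
Variable I : ksubset n k.

Lemma find_iota_lt (P : pred nat) m b :
  (b < find P (iota 0 m))%N -> ~~ P b.
Proof.
move=> lt; have := before_find 0%N lt.
rewrite nth_iota ?add0n => [->//|].
by rewrite (leq_trans lt) // -[X in (_ <= X)%N](size_iota 0 m) find_size.
Qed.

Lemma dist_prev_mem v b : v \in valleys I -> (b < dist_prev I v)%N ->
  v - b%:R \in val I.
Proof.
rewrite inE => /andP[vI _]; elim: b => [_|b IH lt]; first by rewrite subr0.
have := find_iota_lt lt; rewrite inE negb_and negbK.
have -> : v - b.+1%:R + 1 = v - b%:R by rewrite -natr1; ring.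
by rewrite IH ?orbF // ltnW.
Qed.

Lemma dist_next_nonmem v b : v \in valleys I -> (0 < b <= dist_next I v)%N ->
  v + b%:R \notin val I.
Proof.
rewrite inE => /andP[_ vI]; elim: b => // -[_ _|b IH /andP[_ lt]]; first by [].
have := find_iota_lt lt; rewrite inE negb_and negbK.
have -> : v + b.+1%:R + 1 = v + b.+2%:R by rewrite -[in RHS]natr1; ring.
by have /negPf-> := IH (ltnW lt).
Qed.

Lemma dist_prev_gt0 v : v \in valleys I -> (0 < dist_prev I v)%N.
Proof.
move=> vV; case E: (dist_prev I v) => //.
have := prev_peakP n_gt1 vV; rewrite /prev_peak E subr0 inE => /andP[/negP[]].
by move: vV; rewrite inE => /andP[].
Qed.

Lemma dist_next_gt0 v : v \in valleys I -> (0 < dist_next I v)%N.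
Proof.
move=> vV; case E: (dist_next I v) => //.
have := next_peakP n_gt1 vV; rewrite /next_peak E addr0 inE => /andP[/negP[]].
by move: vV; rewrite inE => /andP[].
Qed.

(** Of two valleys above the same peak, the nearer one would have its
successor in I. *)
Lemma prev_peak_inj : {in valleys I &, injective (prev_peak I)}.
Proof.
have main v w : v \in valleys I -> w \in valleys I ->
    prev_peak I v = prev_peak I w -> (dist_prev I w <= dist_prev I v)%N.
  move=> vV wV E; rewrite leqNgt; apply/negP => lt.
  have Ew : w = v + (dist_prev I w - dist_prev I v)%:R.
    rewrite natrB 1?ltnW //; move: E; rewrite /prev_peak => E.
    transitivity (v - (dist_prev I v)%:R + (dist_prev I w)%:R); last by ring.
    by rewrite E; ring.
  have := @dist_prev_mem w (dist_prev I w - dist_prev I v).-1 wV ltac:(lia).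
  have -> : w - ((dist_prev I w - dist_prev I v).-1)%:R = v + 1.
    have Em : (dist_prev I w - dist_prev I v)%:R
        = ((dist_prev I w - dist_prev I v).-1)%:R + 1 :> 'Z_n.
      by rewrite natr1 prednK ?subn_gt0.
    by rewrite {1}Ew Em; ring.
  by move: vV; rewrite inE => /andP[_ /negPf->].
move=> v w vV wV E; have Ed : dist_prev I v = dist_prev I w.
  by apply/eqP; rewrite eqn_leq !main.
by move: E; rewrite /prev_peak Ed => /addIr.
Qed.

Lemma next_peak_inj : {in valleys I &, injective (next_peak I)}.
Proof.
have main v w : v \in valleys I -> w \in valleys I ->
    next_peak I v = next_peak I w -> (dist_next I w <= dist_next I v)%N.
  move=> vV wV E; rewrite leqNgt; apply/negP => lt.
  have Ew : v = w + (dist_next I w - dist_next I v)%:R.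
    rewrite natrB 1?ltnW //; move: E; rewrite /next_peak => E.
    transitivity (w + (dist_next I w)%:R - (dist_next I v)%:R); last by ring.
    by rewrite -E; ring.
  have := @dist_next_nonmem w (dist_next I w - dist_next I v) wV ltac:(lia).
  by rewrite -Ew; move: vV; rewrite inE => /andP[->].
move=> v w vV wV E; have Ed : dist_next I v = dist_next I w.
  by apply/eqP; rewrite eqn_leq !main.
by move: E; rewrite /next_peak Ed => /addIr.
Qed.

Lemma find_iota_eq (P : pred nat) m a : (a < m)%N -> P a ->
  (forall b, (b < a)%N -> ~~ P b) -> find P (iota 0 m) = a.
Proof.
move=> lt Pa amin; have le : (find P (iota 0 m) <= a)%N.
  by rewrite leqNgt; apply/negP => /find_iota_lt; rewrite Pa.
apply/eqP; rewrite eqn_leq le /= leqNgt; apply/negP => lt2.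
have hasP : has P (iota 0 m) by apply/hasP; exists a; rewrite // mem_iota.
have := nth_find 0%N hasP; rewrite nth_iota ?add0n;
  last exact: leq_ltn_trans lt.
by rewrite (negPf (amin _ lt2)).
Qed.

Lemma first_hit_lt (P : pred 'Z_n) i a : P (i + a%:R) ->
  (forall b, (b < a)%N -> ~~ P (i + b%:R)) -> (a < n)%N.
Proof.
move=> Pa amin; rewrite ltnNge; apply/negP => le.
have := amin (a - n)%N ltac:(lia); rewrite natrB // pchar_Zp // subr0.
by rewrite Pa.
Qed.

Lemma ex_prev_valley u : u \in peaks I ->
  exists2 v, v \in valleys I & prev_peak I v = u.
Proof.
move=> uP; have := uP; rewrite inE => /andP[uI uI1].
have ex : exists j, j \notin val I by exists u.
have [a [Pa amin]] := find_up (u + 1) ex.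
have a0 : (0 < a)%N by case: a Pa {amin} => //; rewrite addr0 uI1.
have mem b : (0 < b <= a)%N -> u + b%:R \in val I.
  case: b => // b lt; rewrite -nat1r addrA -[_ \in _]negbK.
  by apply: amin; lia.
exists (u + a%:R).
  by rewrite inE mem ?a0 //= addrAC.
rewrite /prev_peak; suff -> : dist_prev I (u + a%:R) = a by rewrite addrK.
apply: find_iota_eq => [||b lt].
- exact: (@first_hit_lt (fun j => j \notin val I) _ _ Pa amin).
- by rewrite addrK.
rewrite inE negb_and negbK.
have -> : u + a%:R - b%:R = u + (a - b)%:R by rewrite natrB ?addrA // ltnW.
by rewrite mem //; lia.
Qed.

Lemma ex_next_valley u : u \in peaks I ->
  exists2 v, v \in valleys I & next_peak I v = u.
Proof.
move=> uP; have := uP; rewrite inE => /andP[uI uI1].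
have ex : exists j, j \in val I by exists (u + 1).
have [a [Pa amin]] := find_down u ex.
have a0 : (0 < a)%N by case: a Pa {amin} => //; rewrite subr0 (negPf uI).
have lta : (a < n)%N.
  apply: (@first_hit_lt (fun j => (- j) \in val I) (- u)).
    by rewrite opprD opprK.
  by move=> b /amin; rewrite opprD opprK.
exists (u - a%:R).
  rewrite inE Pa /= -(prednK a0) -natr1 opprD addrA subrK.
  by apply: amin; lia.
rewrite /next_peak; suff -> : dist_next I (u - a%:R) = a by rewrite subrK.
apply: find_iota_eq => [||b lt] //; first by rewrite subrK.
rewrite inE negb_and.
have -> : u - a%:R + b%:R + 1 = u - (a - b.+1)%:R.
  by rewrite natrB // -natr1; ring.
by rewrite amin ?orbT //; lia.
Qed.

(** Propagates to all pairs of valleys a relation known for valleys that share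
a peak. *)
Lemma valley_connected (Q : 'Z_n -> 'Z_n -> Prop) :
  (forall v, Q v v) -> (forall u v w, Q u v -> Q v w -> Q u w) ->
  (forall v w, v \in valleys I -> w \in valleys I ->
     next_peak I v = prev_peak I w -> Q v w) ->
  forall v w, v \in valleys I -> w \in valleys I -> Q v w.
Proof.
move=> Q0 Qt Q1 v w vV wV.
have [a Ew] : exists a, w = v + a%:R.
  by exists (val (w - v)); rewrite natr_Zp addrC subrK.
elim/ltn_ind: a v vV Ew => a IH v vV Ew.
have [a0|a0] := posnP a; first by rewrite Ew a0 addr0.
have uP := next_peakP n_gt1 vV.
have [z zV Ez] := ex_prev_valley uP; apply: (Qt _ z); first exact: Q1.
have z0 := dist_prev_gt0 zV; have v0 := dist_next_gt0 vV.
have Ez2 : z = v + (dist_next I v + dist_prev I z)%:R.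
  by rewrite natrD addrA -/(next_peak I v) -Ez subrK.
(* No valley lies strictly between v and z. *)
have le : (dist_next I v + dist_prev I z <= a)%N.
  rewrite leqNgt; apply/negP => lt; have [le|gt] := leqP a (dist_next I v).
    have := @dist_next_nonmem v a vV ltac:(lia).
    by rewrite -Ew; move: wV; rewrite inE => /andP[->].
  have := @dist_prev_mem z (dist_next I v + dist_prev I z - a).-1 zV ltac:(lia).
  have -> : z - (dist_next I v + dist_prev I z - a).-1%:R = w + 1.
    rewrite {1}Ez2 Ew; set m := (_ + _)%N in lt *.
    have -> : m%:R = (m - a).-1%:R + 1 + a%:R :> 'Z_n.
      by rewrite natr1 -natrD; congr (_%:R); lia.
    by ring.
  by move: wV; rewrite inE => /andP[_ /negPf->].
apply: (IH (a - (dist_next I v + dist_prev I z))%N) => //; first lia.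
by rewrite natrB // Ew {1}Ez2; ring.
Qed.

End PeaksValleys.

(** * Isomorphisms of modules *)

Section IsoOfImages.
Local Open Scope ring_scope.
Variables (R : pzRingType) (M N L : lmodType R).
Variables (f : {linear M -> L}) (g : {linear N -> L}).
Hypotheses (f_inj : injective f) (g_inj : injective g).
Hypothesis fg : forall m, exists x, g x = f m.
Hypothesis gf : forall x, exists m, g x = f m.

Definition transfer (m : M) : N := projT1 (cid (fg m)).

Lemma transferE m : g (transfer m) = f m.
Proof. exact: projT2 (cid (fg m)). Qed.

Lemma transfer_linear : linear transfer.
Proof. by move=> a u v; apply: g_inj; rewrite linearP !transferE linearP. Qed.

HB.instance Definition _ := GRing.isLinear.Build R M N *:%R transfer
  transfer_linear.

(** Both modules are identified with their common image. *)
Lemma lmod_iso_images : lmod_iso M N.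
Proof.
exists transfer; pose inv (x : N) := projT1 (cid (gf x)).
have invE x : g x = f (inv x) := projT2 (cid (gf x)).
exists inv => [m|x].
  by apply: f_inj; rewrite -invE transferE.
by apply: g_inj; rewrite transferE -invE.
Qed.

End IsoOfImages.

Section LmodIso.
Local Open Scope ring_scope.
Variables (R : pzRingType).

Lemma lmod_iso_refl (M : lmodType R) : lmod_iso M M.
Proof. by exists idfun; exists id. Qed.

Lemma lmod_iso_sym (M N : lmodType R) : lmod_iso M N -> lmod_iso N M.
Proof.
case=> f [g fK gK]; apply: (@lmod_iso_images _ _ _ N idfun f) => //.
- by move=> x y /(congr1 g); rewrite !fK.
- by move=> x; exists (g x); rewrite gK.
- by move=> x; exists (f x).
Qed.

Lemma lmod_iso_trans (M N P : lmodType R) :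
  lmod_iso M N -> lmod_iso N P -> lmod_iso M P.
Proof. by case=> f bf [g bg]; exists (g \o f); exact: bij_comp. Qed.

End LmodIso.

(** * Translates of k-subsets *)

Section Shift.
Local Open Scope ring_scope.
Variables (n k : nat).

Definition shift_set (s : 'Z_n) (J : {set 'Z_n}) : {set 'Z_n} :=
  [set i | i - s \in J].

Lemma card_shift_set s J : #|shift_set s J| = #|J|.
Proof.
rewrite -(card_imset J (addIr s)); apply: eq_card => i; rewrite inE.
apply/idP/imsetP => [Ji|[j Jj ->]]; last by rewrite addrK.
by exists (i - s); rewrite ?subrK.
Qed.

Lemma shift_card s (I : ksubset n k) : #|shift_set s (val I)| == k.
Proof. by rewrite card_shift_set; exact: (valP I). Qed.

Definition shiftI s (I : ksubset n k) : ksubset n k :=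
  exist (fun J : {set _} => #|J| == k) _ (shift_card s I).

Lemma in_shiftI s I i : (i \in val (shiftI s I)) = (i - s \in val I).
Proof. by rewrite inE. Qed.

Lemma shiftI0 I : shiftI 0 I = I.
Proof. by apply: val_inj; apply/setP => i; rewrite in_shiftI subr0. Qed.

Lemma shiftID s t I : shiftI s (shiftI t I) = shiftI (s + t) I.
Proof.
by apply: val_inj; apply/setP => i; rewrite !in_shiftI opprD addrA.
Qed.

End Shift.

(** * Elements of sums of projectives as families of polynomials *)

Section Action.
Local Open Scope ring_scope.
Variables (F : fieldType) (n k : nat) (n_gt1 : (1 < n)%N).

Local Notation B := (B F n k).
Local Notation L := (rank1 F n_gt1).
Local Notation e := (@idem F n k).

Lemma scale_rank1E (I : ksubset n k) (b : B) (v : L I) :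
  b *: v = Brep_mx I b *m v.
Proof. by []. Qed.

Lemma scale_one (I : ksubset n k) (b : B) j i :
  (b *: rank1_one F n_gt1 I j : L I) i 0 = Brep_mx I b i j.
Proof.
rewrite scale_rank1E /rank1_one mxE (bigD1 j) //= big1 => [|l /negPf lj].
  by rewrite mxE !eqxx mulr1 addr0.
by rewrite mxE lj mulr0.
Qed.

Lemma sumP_idem (S : {set 'Z_n}) (f : sumP F k S) s : s \in S ->
  (submod_val f s : B) * e s = submod_val f s.
Proof.
move=> sS; have /asboolP /(_ s) := valP f; rewrite sS => -[b E].
by rewrite [submod_val f s]E -mulrA idemM eqxx.
Qed.

Lemma sumP_out (S : {set 'Z_n}) (f : sumP F k S) s : s \notin S ->
  submod_val f s = 0.
Proof.
by move=> sS; have /asboolP /(_ s) := valP f; rewrite (negPf sS).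
Qed.

Hypothesis k_ltn : (k < n)%N.

Lemma sumP_ext (I : ksubset n k) (S : {set 'Z_n}) (f g : sumP F k S) :
  (forall s i, s \in S ->
     Brep_mx I (submod_val f s : B) i s = Brep_mx I (submod_val g s : B) i s) ->
  f = g.
Proof.
move=> E; apply: val_inj; apply/ffunP => s.
case: (boolP (s \in S)) => sS; last by rewrite !sumP_out.
apply/eqP; rewrite -subr_eq0; apply/eqP.
have H : ((submod_val f s : B) - submod_val g s) * e s = 0.
  apply: (@Brep_col_inj F n k n_gt1 I k_ltn) => i.
  by rewrite (Brep_mxB n_gt1) !mxE E // subrr.
by rewrite -[RHS]H mulrBl !sumP_idem.
Qed.

Definition sumP_make_fun (S : {set 'Z_n}) (b : 'Z_n -> B) : {ffun 'Z_n ->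
  B^o} :=
  [ffun s => if s \in S then b s * e s else 0].

Lemma sumP_make_sub S b : sumP_sub F k S (sumP_make_fun S b).
Proof. by move=> s; rewrite ffunE; case: (s \in S) => //; exists (b s). Qed.

Definition sumP_make S b : sumP F k S := SubmodOf (asboolT (sumP_make_sub S b)).

Lemma sumP_makeE (S : {set 'Z_n}) b s : s \in S ->
  submod_val (sumP_make S b) s = b s * e s.
Proof. by move=> sS; rewrite /= ffunE sS. Qed.

(** The family whose component at s is the sum over i of q s i times the
reduced path from s to i. *)
Definition poly_family (S : {set 'Z_n}) (q : 'Z_n -> 'Z_n ->
  {poly F}) : sumP F k S :=
  sumP_make S (fun s => \sum_i zpoly n k (q s i) * reduced_path F k s i).

Lemma poly_familyE (I : ksubset n k) (S : {set 'Z_n}) q s i : s \in S ->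
  Brep_mx I (submod_val (poly_family S q) s : B) i s =
    q s i * 'X^(reduced_deg I s i).
Proof.
move=> sS; rewrite sumP_makeE // (Brep_mxM n_gt1) Brep_idem // (Brep_mx_sum
  n_gt1).
rewrite mulmx_suml summxE (bigD1 i) //= big1 => [|l /negPf li].
  rewrite Brep_reduced_path // -scalemxAl mul_delta_mx !mxE !eqxx mulr1 addr0
    //.
by rewrite Brep_reduced_path // -scalemxAl mul_delta_mx !mxE eq_sym li mulr0.
Qed.

(** Paths are products of arrows, hence a diagonal matrix of powers of X
intertwines two rank one modules as soon as it intertwines the arrows. *)
Lemma intertwine (I J : ksubset n k) (M : 'Z_n -> nat) :
  (forall j, arrow_coef F I true j * 'X^(M j) =
    'X^(M (j + 1)) * arrow_coef F J true j) ->
  (forall j, arrow_coef F I false j * 'X^(M j) =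
    'X^(M (j - 1)) * arrow_coef F J false j) ->
  forall (b : B) i j,
  Brep_mx I b i j * 'X^(M j) = 'X^(M i) * Brep_mx J b i j.
Proof.
move=> Ht Hf b i j; rewrite /Brep_mx.
elim/pathalg_ind: (Brepr b) => [|f g IHf IHg|c [s w]].
- by rewrite !rep_mx0 !mxE mul0r mulr0.
- by rewrite !rep_mxD !mxE mulrDl mulrDr IHf IHg.
rewrite !rep_mxU !mxE /=.
case: eqP => [->|_]; last by rewrite !mulr0 mul0r.
case: eqP => [->|_]; last by rewrite !mulr0 mul0r.
rewrite !mulr1 -mulrA [RHS]mulrCA; congr (_ * _).
elim: w => [|a w IH] /=; first by rewrite mul1r mulr1.
rewrite -mulrA IH !mulrA; congr (_ * _).
by case: a; [exact: Ht | exact: Hf].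
Qed.

End Action.

(** * The second syzygy of a rank one module *)

Section Embedding.
Local Open Scope ring_scope.
Variables (F : fieldType) (n k : nat) (n_gt1 : (1 < n)%N) (k_gt0 : (0 < k)%N).
Hypothesis k_ltn : (k < n)%N.
Variable I : ksubset n k.

Local Notation B := (B F n k).
Local Notation L := (rank1 F n_gt1).
Local Notation J := (shiftI (k%:R) I).

Lemma depth_intertwine (b : B) i j :
  Brep_mx I b i j * 'X^(depth I j) = 'X^(depth I i) * Brep_mx J b i j.
Proof.
have Ht (a c : nat) (x y : bool) : (c + ~~ y = a + ~~ x)%N ->
    (if x then 1 else 'X) * 'X^a = 'X^c * (if y then 1 else 'X) :> {poly F}.
  case: x; case: y => /= E; rewrite -?exprS -?exprSr ?mul1r ?mulr1;
    congr (_ ^+ _); lia.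
have Hf (a c : nat) (x y : bool) : (a + ~~ y = c + ~~ x)%N ->
    (if x then 'X else 1) * 'X^a = 'X^c * (if y then 'X else 1) :> {poly F}.
  case: x; case: y => /= E; rewrite -?exprS -?exprSr ?mul1r ?mulr1;
    congr (_ ^+ _); lia.
apply: intertwine => {i}j; rewrite /arrow_coef in_shiftI.
  by apply: Ht; exact: depth_step.
by apply: Hf; have := depth_step I (j - 1); rewrite subrK.
Qed.

(** Embeds L_(I + k) into L_I with image X^(depth i) F[t] at the vertex i. *)
Definition depth_embed (h : L J) : L I := \col_i ('X^(depth I i) * h i 0).

Lemma depth_embed_linear : linear depth_embed.
Proof.
move=> a g h; apply/matrixP => i j; rewrite !scale_rank1E !mxE mulrDr;
  congr (_ + _).
rewrite mulr_sumr; apply: eq_bigr => l _.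
by rewrite mxE mulrA -depth_intertwine mulrA.
Qed.

HB.instance Definition _ := GRing.isLinear.Build B (L J) (L I) *:%R depth_embed
  depth_embed_linear.

Lemma polyX_neq0 m : 'X^m != 0 :> {poly F}.
Proof. by rewrite expf_eq0 polyX_eq0 andbF. Qed.

Lemma depth_embed_inj : injective depth_embed.
Proof.
move=> g h /matrixP E; apply/matrixP => i j; rewrite ord1.
by have := E i 0; rewrite !mxE => /(mulfI (polyX_neq0 _)).
Qed.

Lemma word_prev v : v \in valleys I ->
  word_coef F I (prev_peak I v) (nseq (dist_prev I v) true) = 1.
Proof.
move=> vV; rewrite word_coef_x n_nonmemE // big_nat big1 ?expr0 // => s /= lt.
by rewrite dist_prev_mem.
Qed.

Lemma word_next v : v \in valleys I ->
  word_coef F I (next_peak I v) (nseq (dist_next I v) false) = 1.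
Proof.
move=> vV; rewrite word_coef_y n_memE // big_nat big1 ?expr0 // => s /= lt.
by rewrite -addrA nat1r (negPf (dist_next_nonmem _ _)).
Qed.

(** The paths from u to its two neighbouring valleys act on L_I by 1
([word_prev], [word_next]), so that in L_I the component of D g at u becomes
the difference of the images of the components of g at these valleys. *)
Lemma syzE (g : sumP F k (valleys I)) u v w (i : 'Z_n) :
  v \in valleys I -> w \in valleys I -> prev_peak I v = u ->
    next_peak I w = u ->
  Brep_mx I (submod_val (syz F n_gt1 I g) u : B) i u =
  Brep_mx I (submod_val g v : B) i v - Brep_mx I (submod_val g w : B) i w.
Proof.
move=> vV wV Ev Ew.
have -> : (submod_val (syz F n_gt1 I g) u : B) =
    (submod_val g v : B) * path_class F k u (nseq (dist_prev I v) true) -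
    (submod_val g w : B) * path_class F k u (nseq (dist_next I w) false).
  rewrite /= /syz_fun0 sum_ffunE.
  under eq_bigr => x _ do rewrite !ffunE.
  rewrite sumrB; congr (_ - _).
    rewrite (bigD1 v) //= Ev eqxx big1 ?addr0 // => x /andP[xV /eqP ne].
    by case: eqP => // E; case: ne;
      exact: (prev_peak_inj n_gt1 xV vV (etrans (esym E) (esym Ev))).
  rewrite (bigD1 w) //= Ew eqxx big1 ?addr0 // => x /andP[xV /eqP ne].
  by case: eqP => // E; case: ne;
    exact: (next_peak_inj n_gt1 xV wV (etrans (esym E) (esym Ew))).
rewrite (Brep_mxB n_gt1) !(Brep_mxM n_gt1) !Brep_path_class //.
have -> : word_coef F I u (nseq (dist_prev I v) true) = 1
  by rewrite -Ev word_prev.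
have -> : word_coef F I u (nseq (dist_next I w) false) = 1
  by rewrite -Ew word_next.
rewrite !scale1r ptgt_x ptgt_y.
have -> : u + (dist_prev I v)%:R = v by rewrite -Ev subrK.
have -> : u - (dist_next I w)%:R = w by rewrite -Ew addrK.
rewrite !mxE; congr (_ - _).
  rewrite (bigD1 v) //= big1 => [|l /negPf lv]; last by rewrite mxE lv mulr0.
  by rewrite mxE !eqxx mulr1 addr0.
rewrite (bigD1 w) //= big1 => [|l /negPf lv]; last by rewrite mxE lv mulr0.
by rewrite mxE !eqxx mulr1 addr0.
Qed.

(** At each peak D g compares the two adjacent valleys, and the peaks connect
all valleys in a circle. *)
Lemma syz_eq0 (g : sumP F k (valleys I)) :
  syz F n_gt1 I g = 0 <-> forall v w i, v \in valleys I -> w \in valleys I ->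
    Brep_mx I (submod_val g v : B) i v = Brep_mx I (submod_val g w : B) i w.
Proof.
split=> [E v w i vV wV|E].
  pose Q x y := Brep_mx I (submod_val g x : B) i x =
    Brep_mx I (submod_val g y : B) i y.
  apply: (@valley_connected n k n_gt1 I Q) => //; rewrite /Q.
    by move=> x y z -> ->.
  move=> x y xV yV Exy; apply/eqP; rewrite eq_sym -subr_eq0.
  by rewrite -(syzE _ _ yV xV erefl Exy) E /= ffunE (Brep_mx0 _ n_gt1) mxE.
apply: (@sumP_ext F n k n_gt1 k_ltn I) => u i uP.
have [v vV Ev] := ex_prev_valley n_gt1 uP.
have [w wV Ew] := ex_next_valley n_gt1 uP.
by rewrite (syzE _ _ vV wV Ev Ew) (E v w) // subrr /= ffunE (Brep_mx0 _ n_gt1)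
  mxE.
Qed.

Variable v0 : 'Z_n.
Hypothesis v0V : v0 \in valleys I.

(** By [syz_eq0] the choice of the valley v0 does not affect the value. *)
Definition omega2_embed (g : Omega2 F n_gt1 I) : L I :=
  (submod_val (submod_val g) v0 : B) *: rank1_one F n_gt1 I v0.

Lemma omega2_embed_linear : linear omega2_embed.
Proof. by move=> a f g; rewrite /omega2_embed /= !ffunE scalerDl scalerA. Qed.

HB.instance Definition _ :=
  GRing.isLinear.Build B (Omega2 F n_gt1 I) (L I) *:%R omega2_embed
    omega2_embed_linear.

Lemma Omega2_syz (g : Omega2 F n_gt1 I) : syz F n_gt1 I (submod_val g) = 0.
Proof. by have /asboolP := valP g. Qed.

Lemma omega2_embedE (g : Omega2 F n_gt1 I) v i : v \in valleys I ->
  omega2_embed g i 0 = Brep_mx I (submod_val (submod_val g) v : B) i v.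
Proof.
move=> vV; rewrite scale_one; apply: (proj1 (syz_eq0 _) (Omega2_syz g)) => //.
Qed.

Lemma omega2_embed_inj : injective omega2_embed.
Proof.
move=> f g E; apply: val_inj; apply: (@sumP_ext F n k n_gt1 k_ltn I) => s i sV.
by rewrite -!omega2_embedE ?E.
Qed.

(** Both modules embed into L_I with image X^(depth i) F[t] at the vertex i:
an element of L_I lies in B 1_v when X^(reduced_deg v i) divides its component
at each i, and depth i is the largest of these exponents. *)
Lemma Omega2_iso : lmod_iso (Omega2 F n_gt1 I) (L J).
Proof.
apply: (@lmod_iso_images _ _ _ (L I) omega2_embed depth_embed omega2_embed_inj
  depth_embed_inj) => [g|h].
  have H i : exists q : {poly F}, omega2_embed g i 0 = 'X^(depth I i) * q.
    have [v vV Ed] := depth_valley n_gt1 I k_ltn k_gt0 i.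
    have [q [_ E]] := corner_rho n_gt1 I k_ltn i (submod_val (submod_val g) v :
      B) v.
    by exists q; rewrite (omega2_embedE _ _ vV) E Ed mulrC.
  have [q E] := fin_all_exists H.
  exists (\col_i q i); apply/matrixP => i j;
    rewrite ord1 [LHS]mxE [X in _ * X]mxE.
  by rewrite -E.
pose q v i := h i 0 * 'X^(depth I i - reduced_deg I v i).
have Eq v i : v \in valleys I ->
    Brep_mx I (submod_val (poly_family k (valleys I) q) v : B) i v =
      'X^(depth I i) * h i 0.
  move=> vV; rewrite (poly_familyE n_gt1) // /q -mulrA -exprD subnK
    ?reduced_deg_le //.
  exact: mulrC.
have K : ker (syz F n_gt1 I) (poly_family k (valleys I) q).
  by apply/syz_eq0 => v w i vV wV; rewrite !Eq.
exists (SubmodOf (asboolT K)); apply/matrixP => i j; rewrite ord1 mxE.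
by rewrite (omega2_embedE _ _ v0V) /= Eq.
Qed.

End Embedding.

(** * Maps between rank one modules *)

Lemma linearZE (R : pzRingType) (M N : lmodType R) (f : {linear M -> N})
    (a : R) v :
  f (a *: v)%R = (a *: f v)%R.
Proof. exact: linearZ. Qed.

Section RankOneMaps.
Local Open Scope ring_scope.
Variables (F : fieldType) (n k : nat) (n_gt1 : (1 < n)%N).
Hypothesis k_ltn : (k < n)%N.

Local Notation L := (rank1 F n_gt1).
Local Notation e := (@idem F n k).
Local Notation one := (rank1_one F n_gt1).

Lemma scale_zpolyE (I : ksubset n k) q (v : L I) i :
  (zpoly n k q *: v : L I) i 0 = q * v i 0.
Proof. by rewrite scale_rank1E Brep_zpoly // mul_scalar_mx mxE. Qed.

Lemma scale_idem (I : ksubset n k) i (v : L I) :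
  e i *: v = zpoly n k (v i 0) *: (one I i : L I).
Proof.
apply/matrixP => j l; rewrite ord1 scale_zpolyE scale_rank1E Brep_idem //.
rewrite mxE (bigD1 i) //= big1 => [|a /negPf ai]; last first.
  by rewrite mxE ai andbF mul0r.
by rewrite !mxE !eqxx !andbT addr0 mulrC.
Qed.

Lemma scale_path_class (I : ksubset n k) i w (v : L I) :
  (path_class F k i w *: v : L I) (ptgt ((i, w) : qpath n)) 0
  = word_coef F I i w * v i 0.
Proof.
rewrite scale_rank1E Brep_path_class // mxE (bigD1 i) //= big1 =>
  [|a /negPf ai].
  by rewrite !mxE !eqxx mulr1 addr0.
by rewrite !mxE ai andbF mulr0 mul0r.
Qed.

Lemma one_entry (I : ksubset n k) i : (one I i) i 0 = 1.
Proof. by rewrite mxE !eqxx. Qed.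

(** At each vertex an isomorphism multiplies by a unit of F[t], a constant;
comparing degrees along the arrow x from i to i + 1 shows that i + 1 has the
same status in I and in J. *)
Lemma rank1_iso_inj (I J : ksubset n k) : lmod_iso (L I) (L J) -> I = J.
Proof.
case=> f [g fK gK]; pose p i := (f (one I i)) i 0.
have p1 i : size (p i) = 1%N.
  pose h := g (one J i).
  have : (f (e i *: h)) i 0 = 1.
    rewrite linearZE scale_idem scale_zpolyE one_entry mulr1.
    by rewrite /h gK one_entry.
  rewrite scale_idem linearZE scale_zpolyE -/(p i) => E.
  have : size (h i 0%R * p i) == 1%N by rewrite E size_poly1.
  by rewrite size_mul_eq1 => /andP[_ /eqP].
apply: val_inj; apply/setP => i; rewrite -[i](subrK 1); move: (i - 1) => {}i.
have E : arrow_coef F J true i * p i = arrow_coef F I true i * p (i + 1).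
  have := scale_path_class i [:: true] (f (one I i)).
  rewrite -linearZE [word_coef _ _ _ _]mulr1 => <-.
  have -> : path_class F k i [:: true] *: (one I i : L I) =
      zpoly n k (arrow_coef F I true i) *: (one I (i + 1) : L I).
    apply/matrixP => j l; rewrite ord1 scale_one Brep_path_class //
      scale_zpolyE.
    by rewrite !mxE !eqxx !andbT [word_coef _ _ _ _]mulr1.
  by rewrite linearZE scale_zpolyE.
have /eqP : size (arrow_coef F J true i * p i) =
  size (arrow_coef F I true i * p (i + 1)).
  by rewrite E.
rewrite !size_mul -?size_poly_eq0 ?p1 ?size_poly_eq0 ?arrow_neq0 //.
by rewrite !addn1 /arrow_coef; do 2![case: (_ \in _)];
  rewrite ?size_poly1 ?size_polyX.
Qed.

End RankOneMaps.

(** * Coordinates on the first syzygy *)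

Section Coordinates.
Local Open Scope ring_scope.
Variables (F : fieldType) (n k : nat) (n_gt1 : (1 < n)%N).
Hypothesis k_ltn : (k < n)%N.
Variable I : ksubset n k.

Local Notation B := (B F n k).
Local Notation e := (@idem F n k).
Local Notation Omega := (Omega1 F n_gt1 I).

(** The coordinate of m at the vertex i along the summand B e_u, seen in L_I
through e_u |-> 1_u. *)
Definition kcoord (i : 'Z_n) (m : Omega) (u : 'Z_n) : {poly F} :=
  Brep_mx I (submod_val (submod_val m) u : B) i u.

Lemma kcoordD i m m' u : kcoord i (m + m') u = kcoord i m u + kcoord i m' u.
Proof. by rewrite /kcoord /= !ffunE (Brep_mxD n_gt1) mxE. Qed.

Lemma kcoordZ i (b : B) m u :
  kcoord i (b *: m) u = \sum_l Brep_mx I b i l * kcoord l m u.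
Proof. by rewrite /kcoord /= !ffunE (Brep_mxM n_gt1) mxE. Qed.

Lemma kcoord0 i u : kcoord i 0 u = 0.
Proof. by rewrite /kcoord /= !ffunE (Brep_mx0 _ n_gt1) mxE. Qed.

Lemma kcoord_zpoly i q m u : kcoord i (zpoly n k q *: m) u = q * kcoord i m u.
Proof.
rewrite kcoordZ Brep_zpoly // (bigD1 i) //= big1 => [|l /negPf li].
  by rewrite mxE eqxx mulr1n addr0.
by rewrite mxE eq_sym li mul0r.
Qed.

Lemma kcoord_idem j i m u : kcoord i (e j *: m) u =
  if i == j then kcoord i m u else 0.
Proof.
rewrite kcoordZ Brep_idem // (bigD1 j) //= big1 => [|l /negPf lj].
  by rewrite !mxE !eqxx andbT addr0; case: eqP => [->|]; rewrite ?mul1r ?mul0r.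
by rewrite !mxE lj andbF mul0r.
Qed.

Lemma kcoord_sum i m : \sum_(u in peaks I) kcoord i m u = 0.
Proof.
have /asboolP E := valP m.
have /matrixP /(_ i 0) : Defs.cover F n_gt1 I (submod_val m) = 0 := E.
rewrite summxE [RHS]mxE => H; rewrite -[RHS]H.
by apply: eq_bigr => u _; rewrite scale_one.
Qed.

Lemma kcoord_ext m m' : (forall i u, u \in peaks I ->
  kcoord i m u = kcoord i m' u) -> m = m'.
Proof.
move=> E; apply: val_inj; apply: (@sumP_ext F n k n_gt1 k_ltn I) => u i uP.
exact: E.
Qed.

(** A coordinate along B e_u at i can be any multiple of X^(reduced_deg u i),
and depth i bounds these exponents for all u at once. *)
Lemma kcoord_make (a : 'Z_n -> {poly F}) : \sum_(u in peaks I) a u = 0 ->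
  exists m : Omega, forall i u, u \in peaks I ->
    kcoord i m u = 'X^(depth I i) * a u.
Proof.
move=> a0; pose q u i := a u * 'X^(depth I i - reduced_deg I u i).
have Eq u i : u \in peaks I ->
    Brep_mx I (submod_val (poly_family k (peaks I) q) u : B) i u =
      'X^(depth I i) * a u.
  move=> uP; rewrite (poly_familyE n_gt1) // /q -mulrA -exprD subnK
    ?reduced_deg_le //.
  exact: mulrC.
have K : ker (Defs.cover F n_gt1 I) (poly_family k (peaks I) q).
  apply/matrixP => i j; rewrite ord1 summxE [RHS]mxE.
  rewrite (eq_bigr (fun u => 'X^(depth I i) * a u)) => [|u uP].
    by rewrite -mulr_sumr a0 mulr0.
  by rewrite scale_one Eq.
by exists (SubmodOf (asboolT K)) => i u uP; exact: Eq.
Qed.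

End Coordinates.

Section NotRankOne.
Local Open Scope ring_scope.
Variables (F : fieldType) (n k : nat) (n_gt1 : (1 < n)%N).
Hypothesis k_ltn : (k < n)%N.
Local Notation L := (rank1 F n_gt1).

(** At a single vertex L_I is F[t], where two elements p and q satisfy q p = p
q. In the first syzygy the elements with coordinates concentrated on {u0, u1}
and on {u0, u2} satisfy no such relation. *)
Lemma Omega1_not_rank1 (I J : ksubset n k) : (2 < #|peaks J|)%N ->
  ~ lmod_iso (L I) (Omega1 F n_gt1 J).
Proof.
move=> peaks3 /lmod_iso_sym [f [g fK _]].
have finj : injective f := can_inj fK.
have [u0 [u1 [u2 [[u0P u1P u2P] [n01 n12 n20]]]]] : exists u0 u1 u2,
    [/\ u0 \in peaks J, u1 \in peaks J & u2 \in peaks J] /\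
    [/\ u0 != u1, u1 != u2 & u2 != u0].
  have /card_gt2P [x [y [z [H1 H2]]]] := peaks3.
  by exists x, y, z.
have mk (u : 'Z_n) : u \in peaks J -> u != u0 ->
    exists m : Omega1 F n_gt1 J, forall i v, v \in peaks J ->
      kcoord i m v = 'X^(depth J i) * ((v == u)%:R - (v == u0)%:R).
  move=> uP ne; apply: kcoord_make => //; rewrite sumrB.
  have S w : w \in peaks J -> \sum_(v in peaks J) (v == w)%:R = 1 :> {poly F}.
    by move=> wP; rewrite (bigD1 w) //= eqxx big1 ?addr0 // =>
      v /andP[_ /negPf->].
  by rewrite !S // subrr.
have [m1 E1] := mk u1 u1P ltac:(by rewrite eq_sym).
have [m2 E2] := mk u2 u2P n20.
(* The relation q m1 = p m2 holds at the vertex 0 because it does in L_I; its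
coordinate at u2 forces p = 0. *)
pose p := f m1 0 0; pose q := f m2 0 0.
have E : zpoly n k q *: (idem F k 0 *: m1) = zpoly n k p *: (idem F k 0 *: m2).
  apply: finj; rewrite !linearZE; apply/matrixP => i j; rewrite ord1.
  by rewrite !scale_idem !scale_zpolyE mulrCA.
have EE u : u \in peaks J -> q * kcoord 0 m1 u = p * kcoord 0 m2 u.
  by move=> uP; have := congr1 (fun m => kcoord 0 m u) E;
    rewrite !kcoord_zpoly // !kcoord_idem // eqxx.
have p0 : p = 0.
  have /esym/eqP := EE u2 u2P; rewrite E1 // E2 // eqxx (negPf n20).
  by rewrite [u2 == u1]eq_sym (negPf n12) !subr0 mulr0 mulr0 mulr1 mulf_eq0
    (negPf (polyX_neq0 F _)) orbF => /eqP.
have : idem F k 0 *: m1 = 0.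
  apply: finj; rewrite linearZE linear0; apply/matrixP => i j; rewrite ord1.
  by rewrite scale_idem scale_zpolyE -/p p0 mul0r mxE.
move=> /(congr1 (fun m => kcoord 0 m u1));
  rewrite kcoord_idem // eqxx kcoord0 E1 // eqxx.
rewrite [u1 == u0]eq_sym (negPf n01) subr0 mulr1 => /eqP.
by rewrite (negPf (polyX_neq0 F _)).
Qed.

End NotRankOne.

(** * Syzygies of all orders *)

Section Syzygies.
Local Open Scope ring_scope.
Variables (F : fieldType) (n k : nat) (n_gt1 : (1 < n)%N) (k_gt0 : (0 < k)%N).
Hypothesis k_ltn : (k < n)%N.
Local Notation L := (rank1 F n_gt1).

Lemma in_peaks_shift (I : ksubset n k) s u :
  (u \in peaks (shiftI s I)) = (u - s \in peaks I).
Proof. by rewrite ![_ \in peaks _]inE !in_shiftI addrAC. Qed.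

Lemma card_peaks_shift (I : ksubset n k) s : #|peaks (shiftI s I)| = #|peaks I|.
Proof.
rewrite -[RHS](card_shift_set s); apply: eq_card => u.
by rewrite in_peaks_shift [RHS]inE.
Qed.

Lemma ex_valley (I : ksubset n k) : exists v, v \in valleys I.
Proof. by have [v vV _] := depth_valley n_gt1 I k_ltn k_gt0 0; exists v. Qed.

Lemma syzygy_even t (I : ksubset n k) M :
  is_syzygy n_gt1 (2 * t) I M <-> lmod_iso M (L (shiftI (k * t)%:R I)).
Proof.
elim: t I => [|t IH] I; first by rewrite !muln0 shiftI0.
rewrite mulnS /=.
have Esh : shiftI (k * t)%:R (shiftI k%:R I) = shiftI (k * t.+1)%:R I.
  by rewrite shiftID -natrD mulnS addnC.
have [v vV] := ex_valley I; have iso := Omega2_iso F n_gt1 k_gt0 k_ltn vV.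
split=> [[J [isoJ /IH]]|isoM].
  suff -> : J = shiftI k%:R I by rewrite Esh.
  apply: (@rank1_iso_inj F n k n_gt1).
  exact: lmod_iso_trans (lmod_iso_sym isoJ) iso.
by exists (shiftI k%:R I); split=> //; apply/IH; rewrite Esh.
Qed.

Lemma syzygy_odd t (I : ksubset n k) M : is_syzygy n_gt1 (2 * t).+1 I M ->
  exists s, lmod_iso M (Omega1 F n_gt1 (shiftI s I)).
Proof.
elim: t I => [|t IH] I; first by exists 0; rewrite shiftI0.
rewrite mulnS => -[J [isoJ /IH [s isoM]]].
have [v vV] := ex_valley I; have iso := Omega2_iso F n_gt1 k_gt0 k_ltn vV.
have EJ : J = shiftI k%:R I.
  apply: (@rank1_iso_inj F n k n_gt1).
  exact: lmod_iso_trans (lmod_iso_sym isoJ) iso.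
by exists (s + k%:R); rewrite -shiftID -EJ.
Qed.

Lemma syzygy_self_even t (I : ksubset n k) :
  is_syzygy n_gt1 (2 * t) I (L I) <-> shiftI (k * t)%:R I = I.
Proof.
rewrite syzygy_even; split=> [E|->].
  by have := rank1_iso_inj E => <-.
exact: lmod_iso_refl.
Qed.

Lemma syzygy_self_odd m (I : ksubset n k) : (2 < #|peaks I|)%N -> odd m ->
  ~ is_syzygy n_gt1 m I (L I).
Proof.
move=> p3 om; rewrite -[m]odd_double_half om add1n -mul2n => /syzygy_odd [s].
by apply: Omega1_not_rank1 => //; rewrite card_peaks_shift.
Qed.

End Syzygies.

(** * Common denominators *)

Section Fractions.
Local Open Scope ring_scope.
Local Open Scope quotient_scope.
Variable R : idomainType.

Lemma frac_denom (x : {fraction R}) : exists p q : R,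
  q != 0 /\ tofrac q * x = tofrac p.
Proof.
elim/quotW: x => x; exists (frac x).1, (frac x).2; split;
  first exact: denom_ratioP.
unlock FracField.tofrac; rewrite -[LHS]FracField.pi_mul; apply/eqmodP;
  rewrite /= FracField.equivfE.
rewrite /FracField.mulf /= !numden_Ratio ?oner_neq0 ?mul1r ?denom_ratioP //.
by rewrite mulr1 mulrC.
Qed.

(** The product of the denominators clears them all. *)
Lemma frac_common (I : finType) (a : I -> {fraction R}) :
  exists (q : R) (b : I -> R), q != 0 /\ forall i, tofrac q * a i =
    tofrac (b i).
Proof.
have [p /fin_all_exists [q E]] := fin_all_exists (fun i => frac_denom (a i)).
exists (\prod_i q i), (fun i => (\prod_(j | j != i) q j) * p i); split.
  by apply/prodf_neq0 => i _; case: (E i).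
move=> i; have [_ Ei] := E i.
by rewrite (bigD1 i) //= rmorphM mulrAC Ei -rmorphM mulrC.
Qed.

End Fractions.

(** * The rank of the first syzygy *)

Section Submod.
Local Open Scope ring_scope.
Variables (R : pzRingType) (W : lmodType R) (N : submodule W).

Lemma submodD u v : N u -> N v -> N (u + v).
Proof. by move=> Nu Nv; rewrite -[u]scale1r; exact: submodP. Qed.

Lemma submodZ a u : N u -> N (a *: u).
Proof. by move=> Nu; rewrite -[_ *: _]addr0; apply: submodP => //;
  exact: submod0. Qed.

Lemma submod_sum J (r : seq J) (u : J -> W) :
  (forall i, N (u i)) -> N (\sum_(i <- r) u i).
Proof.
by move=> Nu; elim/big_ind: _ => [|x y|i _];
  [exact: submod0 | exact: submodD |].
Qed.

End Submod.

Section Rank.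
Local Open Scope ring_scope.
Variables (F : fieldType) (n k : nat) (n_gt1 : (1 < n)%N).
Hypothesis k_ltn : (k < n)%N.
Variable I : ksubset n k.

Local Notation B := (B F n k).
Local Notation Omega := (Omega1 F n_gt1 I).
Local Notation zpoly := (@zpoly F n k).
Local Notation e := (@idem F n k).
Local Notation reduced_path := (@reduced_path F n k).
Local Notation K := {fraction {poly F}}.
Local Notation P := #|peaks I|.
Local Notation kcoord := (@kcoord F n k n_gt1 I).

Lemma zpolyM p q : zpoly (p * q) = zpoly p * zpoly q.
Proof.
apply: (@Brep_inj F n k n_gt1 I k_ltn).
by rewrite (Brep_mxM n_gt1) !Brep_zpoly // scalar_mxM.
Qed.

(** The coordinates at the vertex 0, as a vector over the fraction field K of
F[t]. *)
Definition kcoord_row (m : Omega) : 'rV[K]_P :=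
  \row_i tofrac (kcoord 0 m (enum_val i)).

Lemma kcoord_rowD m m' : kcoord_row (m + m') = kcoord_row m + kcoord_row m'.
Proof. by apply/rowP => i; rewrite !mxE kcoordD rmorphD. Qed.

Lemma kcoord_row_zpoly q m : kcoord_row (zpoly q *: m) =
  tofrac q *: kcoord_row m.
Proof. by apply/rowP => i; rewrite !mxE kcoord_zpoly // rmorphM. Qed.

Lemma kcoord_row0 : kcoord_row 0 = 0.
Proof. by apply/rowP => i; rewrite !mxE kcoord0 rmorph0. Qed.

Lemma kcoord_row_idem m : kcoord_row (e 0 *: m) = kcoord_row m.
Proof. by apply/rowP => i; rewrite !mxE kcoord_idem // eqxx. Qed.

Lemma kcoord_row_inj m m' : kcoord_row m = kcoord_row m' ->
  e 0 *: m = e 0 *: m'.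
Proof.
move=> /rowP E; apply: (kcoord_ext k_ltn) => i u uP.
rewrite !kcoord_idem //; case: eqP => // ->.
have := E (enum_rank_in uP u); rewrite !mxE enum_rankK_in // => /eqP.
by rewrite tofrac_eq => /eqP.
Qed.

(** A nonzero multiple of e_l factors through the vertex 0, so that a
divisible submodule is determined by its part at 0. *)
Lemma reduced_path_back l : exists2 q, q != 0 & reduced_path 0 l * reduced_path
  l 0 = zpoly q * e l.
Proof.
have E0 : e l * (reduced_path 0 l * reduced_path l 0) * e l =
  reduced_path 0 l * reduced_path l 0.
  by rewrite mulrA idem_cl ptgt_reduced_word // eqxx -mulrA cl_idem eqxx.
have [q []] := corner_rho n_gt1 I k_ltn l (reduced_path 0 l * reduced_path l 0)
  l; rewrite E0 => E1 E2.
exists q.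
  apply: contraTneq isT => q0; move: E2; rewrite q0 mul0r => /eqP.
  rewrite (Brep_mxM n_gt1) !Brep_path_class // !ptgt_reduced_word //.
  rewrite -scalemxAl -scalemxAr mul_delta_mx scalerA !mxE !eqxx mulr1.
  by rewrite mulf_eq0 !(negPf (word_coef_neq0 _ _ _ _)).
by rewrite E1 (reduced_path_id F n_gt1 k_ltn).
Qed.

Lemma idem_reduced_path l : e 0 * reduced_path l 0 = reduced_path l 0.
Proof. by rewrite idem_cl ptgt_reduced_word // eqxx. Qed.

Variables (W : lmodType B) (f : {linear Omega -> W}).
Hypothesis locf : is_generic_localization f.

Lemma loc_inj m : f m = 0 -> m = 0.
Proof.
have [_ H _] := locf => /H [z [cz z0 zm]].
have [q Eq] := central_zpoly n_gt1 I k_ltn cz.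
have q0 : q != 0 by apply: contraNneq z0 => q0; rewrite Eq q0 zpoly0.
apply: (kcoord_ext k_ltn) => i u uP; apply: (mulfI q0).
by rewrite -kcoord_zpoly // -Eq zm !kcoord0 mulr0.
Qed.

Lemma loc_eq m m' : f m = f m' -> m = m'.
Proof.
move=> E; apply/eqP; rewrite -subr_eq0; apply/eqP/loc_inj.
by rewrite linearB E subrr.
Qed.

Lemma loc_frac w : exists q m, q != 0 /\ zpoly q *: w = f m.
Proof.
have [_ _ /(_ w) [z [m [cz z0 E]]]] := locf.
have [q Eq] := central_zpoly n_gt1 I k_ltn cz.
exists q, m; rewrite -Eq; split=> //.
by apply: contraNneq z0 => q0; rewrite Eq q0 zpoly0.
Qed.

Lemma div_zpoly (N : submodule W) q w : divisible_submod N -> q != 0 ->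
  N (zpoly q *: w) -> N w.
Proof.
move=> dN q0; apply: dN; first exact: zpoly_central.
by apply: contraNneq q0 => /(zpoly_eq0 n_gt1 I) ->.
Qed.

(** The K-subspace attached to N: all vectors proportional to a coordinate row
of an element of N. *)
Definition rowset (N : submodule W) (a : 'rV[K]_P) : Prop :=
  exists p m, [/\ p != 0, N (f m) & kcoord_row m = tofrac p *: a].

Lemma rowset_mem (N : submodule W) m : divisible_submod N ->
  rowset N (kcoord_row m) <-> N (f (e 0 *: m)).
Proof.
move=> dN; split=> [[p [m' [p0 Nm E]]]|Nm]; last first.
  by exists 1, (e 0 *: m); rewrite oner_neq0 rmorph1 scale1r kcoord_row_idem.
apply: (div_zpoly dN p0); rewrite -linearZE.
have <- : e 0 *: m' = zpoly p *: (e 0 *: m).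
  rewrite scalerA (zpoly_central p) -scalerA; apply: kcoord_row_inj.
  by rewrite kcoord_row_zpoly.
by rewrite linearZE; exact: submodZ.
Qed.

(** Returning from the vertex 0 to l along a reduced path recovers a nonzero
multiple of the part of w at l. *)
Lemma rowset_gen (N : submodule W) w : divisible_submod N ->
  (forall b q m, q != 0 -> zpoly q *: (b *: w) = f m ->
    rowset N (kcoord_row m)) -> N w.
Proof.
move=> dN H; rewrite -[w]scale1r -(idem_sum F n k) scaler_suml.
apply: submod_sum => l.
have [q [m [q0 E]]] := loc_frac (reduced_path l 0 *: w).
have /(rowset_mem m dN) := H _ _ _ q0 E.
rewrite linearZE -E !scalerA ?mulrA -(zpoly_central q) -mulrA idem_reduced_path
  -scalerA.
move=> /(div_zpoly dN q0) Nw; have [p p0 Ep] := reduced_path_back l.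
apply: (div_zpoly dN p0); rewrite scalerA -Ep -scalerA; exact: submodZ.
Qed.

Lemma rowset0 (N : submodule W) : rowset N 0.
Proof. by exists 1, 0; rewrite oner_neq0 linear0 kcoord_row0 scaler0;
  split=> //; exact: submod0. Qed.

Lemma rowsetD (N : submodule W) a b : rowset N a -> rowset N b ->
  rowset N (a + b).
Proof.
case=> p [m [p0 Nm E]] [q [m' [q0 Nm' E']]].
exists (p * q), (zpoly q *: m + zpoly p *: m'); split.
- by rewrite mulf_neq0.
- by rewrite linearD !linearZE; apply: submodD; exact: submodZ.
rewrite kcoord_rowD !kcoord_row_zpoly E E' !scalerA -!rmorphM [q * p]mulrC.
by rewrite scalerDr.
Qed.

Lemma rowsetZ (N : submodule W) c a : rowset N a -> rowset N (c *: a).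
Proof.
case=> p [m [p0 Nm E]]; have [x [y [y0 Ec]]] := frac_denom c.
exists (p * y), (zpoly x *: m); split.
- by rewrite mulf_neq0.
- by rewrite linearZE; exact: submodZ.
by rewrite kcoord_row_zpoly E !scalerA rmorphM -mulrA Ec mulrC.
Qed.

Section RowsSubmod.
Variables (s : nat) (A : 'M[K]_(s, P)).

(** Converse construction: the submodule attached to the row space of A.
Letting b vary brings the parts of w at all vertices to the vertex 0. *)
Definition rows_submod_car (w : W) : Prop :=
  forall b q m, q != 0 -> zpoly q *: (b *: w) = f m -> (kcoord_row m <= A)%MS.

Lemma tofrac_scale_sub q (a : 'rV[K]_P) : q != 0 ->
  (tofrac q *: a <= A)%MS -> (a <= A)%MS.
Proof.
by move=> q0; rewrite eqmx_scale // tofrac_eq0.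
Qed.

Lemma rows_submod0 : rows_submod_car 0.
Proof.
move=> b q m _; rewrite !scaler0 => /esym /loc_inj ->.
by rewrite kcoord_row0 sub0mx.
Qed.

Lemma rows_submodP a u v : rows_submod_car u -> rows_submod_car v ->
  rows_submod_car (a *: u + v).
Proof.
move=> Su Sv b q m q0 E.
have [q1 [m1 [q10 E1]]] := loc_frac ((b * a) *: u).
have [q2 [m2 [q20 E2]]] := loc_frac (b *: v).
have S1 := Su _ _ _ q10 E1; have S2 := Sv _ _ _ q20 E2.
have q120 : q1 * q2 != 0 by rewrite mulf_neq0.
apply: (tofrac_scale_sub q120); rewrite -kcoord_row_zpoly.
have -> : zpoly (q1 * q2) *: m = zpoly (q * q2) *: m1 + zpoly (q * q1) *: m2.
  apply: loc_eq; rewrite linearD !linearZE -E -E1 -E2 scalerDr [b *: (a *: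
    u)]scalerA.
  move: (_ *: u) (_ *: v) => x y; rewrite !scalerA -!zpolyM scalerDr.
  by congr (zpoly _ *: _ + zpoly _ *: _); ring.
by rewrite kcoord_rowD !kcoord_row_zpoly addmx_sub ?scalemx_sub.
Qed.

Definition rows_submod : submodule W := Submodule rows_submod0 rows_submodP.

Lemma rows_submod_div : divisible_submod rows_submod.
Proof.
move=> z w cz z0 Nw b q m q0 E.
have [p Ep] := central_zpoly n_gt1 I k_ltn cz.
have p0 : p != 0 by apply: contraNneq z0 => p0; rewrite Ep p0 zpoly0.
apply: (tofrac_scale_sub p0); rewrite -kcoord_row_zpoly; apply: (Nw b q _ q0).
rewrite linearZE -E -Ep !scalerA; congr (_ *: _).
by rewrite -cz mulrA (cz (zpoly q)).
Qed.

Lemma rows_submod_f m : (kcoord_row m <= A)%MS -> rows_submod (f (e 0 *: m)).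
Proof.
move=> mA b q m' q0 E.
have [p [Ep _]] := corner_rho n_gt1 I k_ltn 0 b 0.
have E1 : kcoord_row m' = kcoord_row (zpoly (q * p) *: m).
  have -> : m' = (zpoly q * (b * e 0)) *: m.
    by apply: loc_eq; rewrite -E !linearZE !scalerA mulrA.
  rewrite -kcoord_row_idem scalerA mulrA -(zpoly_central q) -mulrA [e 0 * (_ *
    _)]mulrA Ep.
  by rewrite (reduced_path_id F n_gt1 k_ltn) mulrA -zpolyM -scalerA
    !kcoord_row_zpoly kcoord_row_idem.
by rewrite E1 kcoord_row_zpoly scalemx_sub.
Qed.

End RowsSubmod.

(** The subspaces attached to the members of the chain gain one dimension at
each step. A row of N (i + 1) outside that of N i, added to the latter, yields
a divisible submodule above N i, which must be N (i + 1) because nothing lies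
strictly between. *)
Lemma chain_matrix (N : nat -> submodule W) (r : nat) :
  [/\ forall w : W, N 0%N w <-> w = 0,
        forall w : W, N r w,
        forall i, (i <= r)%N -> divisible_submod (N i)
      & forall i, (i < r)%N ->
        [/\ sub_submod (N i) (N i.+1), ~ sub_submod (N i.+1) (N i)
          & forall N' : submodule W, divisible_submod N' ->
              sub_submod (N i) N' -> sub_submod N' (N i.+1) ->
              sub_submod N' (N i) \/ sub_submod (N i.+1) N']] ->
  forall i, (i <= r)%N -> exists A : 'M[K]_(i, P),
    row_free A /\ forall a, rowset (N i) a <-> (a <= A)%MS.
Proof.
move=> [N0 Nr dN cN]; elim=> [_|i IH lt].
  exists 0; split; first by rewrite /row_free mxrank0.
  move=> a; split=> [[p [m [p0 /N0 /loc_inj -> E]]]|].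
    suff -> : a = 0 by exact: sub0mx.
    move/esym/eqP: E; rewrite kcoord_row0 scaler_eq0 tofrac_eq0 (negPf p0) =>
      /eqP //.
  by move=> /submxP [D ->]; rewrite mulmx0; exact: rowset0.
have [A [fA EA]] := IH (ltnW lt); have [sN nN coverN] := cN i lt.
have dNi := dN i (ltnW lt); have dNi1 := dN i.+1 lt.
(* By [rowset_gen], some element of N i.+1 has its coordinate row outside the
subspace attached to N i. *)
have [m [Nm nm]] : exists m, rowset (N i.+1) (kcoord_row m) /\
  ~ rowset (N i) (kcoord_row m).
  apply: contrapT => H; apply: nN => w Nw.
  apply: rowset_gen => // b q m q0 E; apply: contrapT => nm; apply: H.
  exists m; split=> //; apply/rowset_mem => //.
  by rewrite linearZE -E; do 3!apply: submodZ.
have nmA : ~~ (kcoord_row m <= A)%MS by apply/negP => /EA.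
pose A' := col_mx (kcoord_row m) A.
have sA' : (A <= A')%MS by rewrite -addsmxE addsmxSr.
have mA' : (kcoord_row m <= A')%MS by rewrite -addsmxE addsmxSl.
exists A'; split.
  have rA : \rank A = i by apply/eqP.
  have : (A < A')%MS by rewrite /ltmx sA'; apply: contra nmA;
    exact: submx_trans.
  by move/rank_ltmx; rewrite rA /row_free eqn_leq rank_leq_row.
have rA' a : (a <= A')%MS -> rowset (N i.+1) a.
  rewrite -addsmxE => /sub_addsmxP [[u v] /= ->]; apply: rowsetD.
    by rewrite [u]mx11_scalar mul_scalar_mx; exact: rowsetZ.
  have /EA [p [m' [p0 Nm' E]]] : (v *m A <= A)%MS by exact: submxMl.
  by exists p, m'; split=> //; exact: sN.
move=> a; split; last exact: rA'.
have sub1 : sub_submod (N i) (rows_submod A').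
  move=> w Nw b q m' q0 E; apply: submx_trans sA'; apply/EA.
  exists 1, m'; rewrite oner_neq0 -E rmorph1 scale1r; split=> //.
  by do 2!apply: submodZ.
have sub2 : sub_submod (rows_submod A') (N i.+1).
  move=> w Sw; apply: rowset_gen => // b q m' q0 E; apply: rA'.
  exact: Sw E.
have [s|s] := coverN _ (@rows_submod_div _ A') sub1 sub2.
  by case: nm; apply/rowset_mem => //; apply: s; exact: rows_submod_f.
case=> p [m' [p0 /s Nm' E]].
apply: (tofrac_scale_sub p0); rewrite -E; apply: (Nm' 1 1 m' (oner_neq0 _)).
by rewrite zpoly1 !scale1r.
Qed.

End Rank.

Section RankOmega.
Local Open Scope ring_scope.
Variables (F : fieldType) (n k : nat) (n_gt1 : (1 < n)%N).
Hypothesis k_ltn : (k < n)%N.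
Variable I : ksubset n k.
Local Notation K := {fraction {poly F}}.

(** Clearing denominators and multiplying by X^depth turns a vector with zero
sum into the coordinates of an element ([kcoord_make]). *)
Lemma row_spanE (a : 'rV[K]_#|peaks I|) :
  (exists p m, p != 0 /\ @kcoord_row F n k n_gt1 I m = tofrac p *: a) <->
  \sum_i a 0 i = 0.
Proof.
split=> [[p [m [p0 E]]]|a0].
  have : \sum_i (kcoord_row m) 0 i = 0.
    rewrite -[RHS](rmorph0 (@tofrac {poly F})) -(kcoord_sum 0 m) rmorph_sum.
    rewrite [RHS](big_enum_val (fun u => tofrac (kcoord 0 m u))).
    by apply: eq_bigr => i _; rewrite mxE.
  rewrite E; under eq_bigr => i _ do rewrite mxE.
  by rewrite -mulr_sumr => /eqP; rewrite mulf_eq0 tofrac_eq0 (negPf p0) => /eqP.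
have [q [b [q0 Eb]]] := frac_common (fun i => a 0 i).
pose c (u : 'Z_n) : {poly F} := \sum_(i | enum_val i == u) b i.
have Ec i : c (enum_val i) = b i.
  by rewrite /c (eq_bigl (pred1 i)) ?big_pred1_eq // => j;
    rewrite /= (inj_eq enum_val_inj).
have c0 : \sum_(u in peaks I) c u = 0.
  apply/eqP; rewrite -tofrac_eq0 rmorph_sum (big_enum_val (fun u =>
    tofrac (c u))) /=.
  rewrite (eq_bigr (fun i => tofrac q * a 0 i)) => [|i _]; last
    by rewrite Ec Eb.
  by rewrite -mulr_sumr a0 mulr0.
have [m Em] := kcoord_make n_gt1 k_ltn c0.
exists ('X^(depth I 0) * q), m; split; first by rewrite mulf_neq0 ?polyX_neq0.
by apply/rowP => i; rewrite !mxE Em ?enum_valP // Ec !rmorphM /= -Eb mulrA.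
Qed.

(** The last member of the chain yields the hyperplane of vectors with zero
sum, the kernel of a column of ones. *)
Lemma rank_peaks r : (0 < r)%N -> has_rank (Omega1 F n_gt1 I) r ->
  #|peaks I| = r.+1.
Proof.
move=> r0 [W [f [locf [N chain]]]].
have [_ Nr _ _] := chain.
have [A [fA EA]] := chain_matrix k_ltn locf chain (leqnn r).
pose C : 'M[K]_(#|peaks I|, 1) := const_mx 1.
have Esum a : a *m C = (\sum_i a 0 i)%:M.
  apply/matrixP => i j; rewrite !ord1 !mxE eqxx mulr1n.
  by apply: eq_bigr => l _; rewrite mxE mulr1.
have EK (a : 'rV[K]_#|peaks I|) : (a <= A)%MS = (a <= kermx C)%MS.
  apply/idP/idP => [aA|/sub_kermxP].
    have [p [m [p0 _ E]]] := proj2 (EA a) aA; apply/sub_kermxP.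
    rewrite Esum; suff -> : \sum_i a 0 i = 0 by exact: raddf0.
    by apply/row_spanE; exists p, m.
  rewrite Esum => /matrixP /(_ 0 0);
    rewrite !mxE mulr1n => /row_spanE [p [m [p0 E]]].
  by apply: (proj1 (EA a)); exists p, m; split.
have ErA : \rank A = \rank (kermx C).
  apply/eqP; rewrite eqn_leq; apply/andP; split; apply: mxrankS;
    apply/row_subP => i; first by rewrite -EK row_sub.
  by rewrite EK row_sub.
move: ErA; rewrite (eqP fA) mxrank_ker.
have -> : \rank C = (0 < #|peaks I|)%N.
  case: posnP => [P0|P0].
    apply/eqP; rewrite mxrank_eq0; apply/eqP/matrixP => i j.
    by exfalso; move: (ltn_ord i); rewrite [X in (_ < X)%N]P0.
  apply/eqP; rewrite eqn_leq rank_leq_col /= lt0n mxrank_eq0.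
  apply/eqP => /matrixP /(_ (Ordinal P0) 0); rewrite !mxE => /eqP.
  by rewrite oner_eq0.
by move: r0; case: posnP => [->|] /=; lia.
Qed.

End RankOmega.

(** * Maximal cyclic intervals *)

Section Blocks.
Local Open Scope ring_scope.
Variables (n k : nat) (n_gt1 : (1 < n)%N).
Variable I : ksubset n k.

Definition starts : {set 'Z_n} :=
  [set s | (s \in val I) && (s - 1 \notin val I)].

Definition block_len (s : 'Z_n) : nat := find (fun a =>
  s + a%:R \notin val I) (iota 0 n).
(** The distance from s to the following start; it is n when s is the only
one. *)
Definition next_dist (s : 'Z_n) : nat :=
  (find (fun a => s + a.+1%:R \in starts) (iota 0 n)).+1.
Definition block (s : 'Z_n) : {set 'Z_n} :=
  [set x | (val (x - s)%R < block_len s)%N].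

Lemma card_starts : #|starts| = #|peaks I|.
Proof.
rewrite -[RHS](card_shift_set 1); apply: eq_card => s.
by rewrite !inE andbC subrK.
Qed.

Lemma val_lt (x : 'Z_n) : (val x < n)%N.
Proof. by have := ltn_ord x; rewrite [X in (_ < X)%N](Zp_cast n_gt1). Qed.

Lemma natr_val (x y : 'Z_n) : x = y + (val (x - y))%:R.
Proof. by rewrite natr_Zp addrC subrK. Qed.

Lemma val_addn (s x : 'Z_n) a : x = s + a%:R -> (a < n)%N -> val (x - s) = a.
Proof. by move=> -> lt; rewrite addrC addKr val_Zn. Qed.

Lemma find_iotaP (P : pred nat) m : (exists2 a, (a < m)%N & P a) ->
  P (find P (iota 0 m)) /\ (find P (iota 0 m) < m)%N.
Proof.
case=> a lt Pa; have hasP : has P (iota 0 m).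
  by apply/hasP; exists a; rewrite // mem_iota.
have lt2 := hasP; rewrite has_find size_iota in lt2.
have := nth_find 0%N hasP; rewrite nth_iota ?add0n //; split.
Qed.

Lemma card_range s a b : (b <= n)%N ->
  #|[set x : 'Z_n | (a <= val (x - s)%R < b)%N]| = (b - a)%N.
Proof.
move=> le; pose h (j : 'I_(b - a)) : 'Z_n := s + (a + j)%:R.
have lt (j : 'I_(b - a)) : (a + j < n)%N by have := ltn_ord j; lia.
rewrite -[RHS]card_ord -(@card_imset _ _ h); last first.
  move=> i j /addrI E; apply: val_inj; apply: (@addnI a).
  by rewrite -[LHS](val_Zn n_gt1 (lt i)) E val_Zn.
apply: eq_card => x; rewrite inE; apply/idP/imsetP => [/andP[l1 l2]|[j _ ->]].
  have lt2 : (val (x - s)%R - a < b - a)%N by lia.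
  by exists (Ordinal lt2); rewrite // /h /= subnKC // -natr_val.
by rewrite /h (@val_addn s _ (a + j)) //; have := ltn_ord j; lia.
Qed.

Lemma block_len_mem s b : (b < block_len s)%N -> s + b%:R \in val I.
Proof. by move=> /find_iota_lt; rewrite negbK. Qed.

Lemma start_mem s : s \in starts -> s \in val I.
Proof. by rewrite inE => /andP[]. Qed.

Lemma start_pred s : s \in starts -> s - 1 \notin val I.
Proof. by rewrite inE => /andP[]. Qed.

Lemma mem_block s x : (x \in block s) = (val (x - s)%R < block_len s)%N.
Proof. by rewrite inE. Qed.

Lemma block_sub s : block s \subset val I.
Proof.
by apply/subsetP => x; rewrite mem_block => /block_len_mem; rewrite -natr_val.
Qed.

(** The predecessor of a start is outside I, so a start can only be the first
element of a block. *)
Lemma start_sep s d : s + d%:R \in starts -> (0 < d)%N -> (block_len s <= d)%N.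
Proof.
move=> tS d0; rewrite leqNgt; apply/negP => lt.
have := start_pred tS; rewrite -addrA -(prednK d0) -natr1 addrK block_len_mem
  //; lia.
Qed.

Hypothesis k_ltn : (k < n)%N.

Lemma block_lenP s : s + (block_len s)%:R \notin val I /\ (block_len s < n)%N.
Proof.
apply: (@find_iotaP (fun a => s + a%:R \notin val I)).
have [j jI] := ex_nonmem n_gt1 I k_ltn.
by exists (val (j - s)); [exact: val_lt | rewrite -natr_val].
Qed.

Lemma block_len_lt s : (block_len s < n)%N. Proof. by case: (block_lenP s). Qed.

Lemma block_len_gt0 s : s \in val I -> (0 < block_len s)%N.
Proof.
by move=> sI; case: (block_lenP s); case: (block_len s) => //; rewrite addr0 sI.
Qed.

Lemma mem_blockD s a : (a < block_len s)%N -> s + a%:R \in block s.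
Proof.
by move=> lt; rewrite mem_block (@val_addn s _ a) // (ltn_trans lt
  (block_len_lt s)).
Qed.

Lemma start_block s : s \in starts -> s \in block s.
Proof. by move=> sS; rewrite mem_block subrr block_len_gt0 // start_mem. Qed.

(** The element before the start s is outside I, so no block runs through it:
blocks do not wrap around when positions are measured from s. *)
Lemma block_end s t a : s \in starts -> t = s + a%:R -> (a < n)%N ->
  (a + block_len t < n)%N.
Proof.
move=> sS Et lt; rewrite ltnNge; apply/negP => le.
have /negP[] := start_pred sS.
have -> : s - 1 = t + (n - a.+1)%:R.
  rewrite Et natrB // pchar_Zp // -natr1; ring.
by apply: block_len_mem; lia.
Qed.

Lemma card_block s : #|block s| = block_len s.
Proof. by rewrite -[RHS]subn0 -(@card_range s) // ltnW // block_len_lt. Qed.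

Lemma mem_in_block x : x \in val I -> exists2 s, s \in starts & x \in block s.
Proof.
move=> xI; have [a [Pa amin]] := find_down x (ex_nonmem n_gt1 I k_ltn).
have a0 : (0 < a)%N by case: a Pa {amin} => //; rewrite subr0 xI.
exists (x - a.-1%:R).
  rewrite inE; have := amin a.-1 ltac:(lia); rewrite negbK => -> /=.
  by rewrite -addrA -opprD natr1 prednK.
rewrite mem_block opprB addrC subrK.
have Ex : x = x - a.-1%:R + a.-1%:R by rewrite subrK.
have lt : (a.-1 < block_len (x - a.-1%:R)%R)%N.
  rewrite ltnNge; apply/negP => le.
  case: (block_lenP (x - a.-1%:R));
    have -> : x - a.-1%:R + (block_len (x - a.-1%:R))%:R =
      x - (a.-1 - block_len (x - a.-1%:R)%R)%:R by rewrite natrB //; ring.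
  by rewrite (negPf (amin _ _)) //; lia.
by rewrite val_Zn // (ltn_trans lt) // block_len_lt.
Qed.

Lemma block_interval s : s \in val I -> is_cyclic_interval (block s).
Proof.
move=> sI; have lt : (block_len s < n.+1)%N
  by rewrite ltnS ltnW // block_len_lt.
apply/existsP; exists s; apply/existsP; exists (Ordinal lt).
rewrite /= block_len_gt0 //=; apply/eqP/setP => x.
apply/idP/imsetP => [xb|[j _ ->]]; last exact: mem_blockD.
rewrite mem_block in xb; exists (Ordinal xb); rewrite //= -natr_val //.
Qed.

(** A cyclic interval inside I lies in the block through any of its elements,
and a block cannot be extended on either side. *)
Lemma max_intervalP S :
  is_max_interval I S <-> exists2 s, s \in starts & S = block s.
Proof.
split=> [/maxsetP [/andP[/existsP[a /existsP[d /andP[d0 /eqP ES]]] SI] max]|[s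
  sS ->]].
  have aI : a \in val I.
    apply: (subsetP SI); rewrite ES; apply/imsetP.
    by exists (Ordinal d0); rewrite // addr0.
  have [s sS asb] := mem_in_block aI.
  have Sb : S \subset block s.
    rewrite ES; apply/subsetP => x /imsetP[j _ ->].
    rewrite mem_block in asb; set b := val (a - s) in asb.
    have Ea : a = s + b%:R by exact: natr_val.
    rewrite Ea -addrA -natrD; apply: mem_blockD; rewrite ltnNge;
      apply/negP => le.
    have lt : (block_len s - b < d)%N by have := ltn_ord j; lia.
    case: (block_lenP s) => /negP[]; apply: (subsetP SI); rewrite ES;
      apply/imsetP.
    exists (Ordinal lt) => //=; rewrite {1}Ea -addrA -natrD subnKC //;
      exact: ltnW.
  exists s => //; apply/esym; apply: max => //.
  by rewrite block_interval ?start_mem // block_sub.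
apply/maxsetP; split; first by rewrite block_interval ?start_mem // block_sub.
move=> T /andP[/existsP[a /existsP[d /andP[d0 /eqP ET]]] TI] bT.
apply/eqP; rewrite eqEsubset bT andbT.
have mT j : (j < d)%N -> a + j%:R \in val I.
  by move=> lt; apply: (subsetP TI); rewrite ET; apply/imsetP;
    exists (Ordinal lt).
have Es : s = a.
  have := subsetP bT _ (start_block sS);
    rewrite ET => /imsetP[[[|j] lt] _ /= Es].
    by rewrite Es addr0.
  case/negP: (start_pred sS); rewrite Es -natr1 addrA addrK; apply: mT; lia.
rewrite {1}ET; apply/subsetP => x /imsetP[j _ ->]; rewrite -Es.
apply: mem_blockD; rewrite ltnNge; apply/negP => le.
case: (block_lenP s) => /negP[]; rewrite {1}Es; apply: mT;
  exact: leq_ltn_trans le _.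
Qed.

End Blocks.

Section Next.
Local Open Scope ring_scope.
Variables (n k : nat) (n_gt1 : (1 < n)%N).
Hypothesis k_ltn : (k < n)%N.
Variable I : ksubset n k.
Local Notation next_dist := (next_dist I).
Local Notation block_len := (block_len I).
Local Notation block := (block I).
Local Notation starts := (starts I).

Lemma next_distP s j : j \in starts ->
  s + (next_dist s)%:R \in starts /\ (next_dist s <= n)%N.
Proof.
move=> jS; apply: (@find_iotaP (fun a => s + a.+1%:R \in starts)).
exists (val (j - (s + 1))); first exact: val_lt.
by rewrite -nat1r addrA -natr_val.
Qed.

Lemma next_dist_min s e : (0 < e < next_dist s)%N -> s + e%:R \notin starts.
Proof.
case: e => // e /= lt; apply: (@find_iota_lt (fun a =>
  s + a.+1%:R \in starts) n).
exact: lt.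
Qed.

Lemma next_dist_le s e : (0 < e)%N -> s + e%:R \in starts ->
  (next_dist s <= e)%N.
Proof.
by move=> e0 eS; rewrite leqNgt; apply/negP => lt; have := @next_dist_min s e;
  rewrite e0 lt eS => /(_ isT).
Qed.

Lemma gap_nonmem s z : (block_len s <= z < next_dist s)%N ->
  s + z%:R \notin val I.
Proof.
elim: z => [|z IH] /andP[le lt].
  have b0 : block_len s = 0%N by lia.
  by have [] := block_lenP n_gt1 I k_ltn s; rewrite b0.
have [E|ne] := eqVneq (block_len s) z.+1; first
  by rewrite -E; case: (block_lenP n_gt1 I k_ltn s).
have := @next_dist_min s z.+1 lt; rewrite inE -natr1 addrA addrK negb_and negbK.
case/orP => //; rewrite (negPf (IH _)) //; lia.
Qed.

Lemma block_len_lt_next s : s \in starts -> (block_len s < next_dist s)%N.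
Proof.
move=> sS; have [tS _] := next_distP s sS.
have le := start_sep n_gt1 tS (ltn0Sn _ : (0 < next_dist s)%N).
rewrite ltn_neqAle le andbT; apply/eqP => E.
by case: (block_lenP n_gt1 I k_ltn s); rewrite E (start_mem tS).
Qed.

(** Measured from s, the block of s ends before the next start and the next
block does not wrap around; between the two there is no element of I, since
the first one would be a start. *)
Lemma gap_block s : s \in starts -> (next_dist s < n)%N ->
  gap I (block s) (block (s + (next_dist s)%:R)) =
  [set z | (block_len s <= val (z - s)%R < next_dist s)%N].
Proof.
move=> sS ltn; set t := s + (next_dist s)%:R.
have [tS _] := next_distP s sS; rewrite -/t in tS.
have bE := block_end n_gt1 k_ltn sS erefl ltn; rewrite -/t in bE.
apply/setP => z; rewrite !inE; apply/idP/idP => [/andP[zI]|/andP[le lt]].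
  case/existsP => a /andP[aS /existsP[b /andP[bS lt]]].
  rewrite !mem_block in aS bS; move: lt; rewrite /before.
  set ze := val (z - s); set al := val (a - s) in aS;
    set be := val (b - t) in bS.
  have Ez : z = s + ze%:R by exact: natr_val.
  have Ea : a = s + al%:R by exact: natr_val.
  have Eb : b = s + (next_dist s + be)%:R
    by rewrite natrD addrA; exact: natr_val.
  have zel : (block_len s <= ze)%N.
    by rewrite leqNgt; apply/negP => /block_len_mem; rewrite -Ez (negPf zI).
  have zn : (ze < n)%N by exact: val_lt.
  rewrite (@val_addn _ n_gt1 a z (ze - al)%N); last by lia.
    rewrite (@val_addn _ n_gt1 a b (next_dist s + be - al)%N); last by lia.
      move=> lt; rewrite zel /= ltnNge; apply/negP => le.
      case/negP: zI; rewrite Ez;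
        have -> : ze = (next_dist s + (ze - next_dist s))%N by lia.
      by rewrite natrD addrA -/t; apply: block_len_mem; lia.
    by rewrite Ea Eb -addrA -natrD; congr (_ + _%:R);
      have := block_len_lt_next sS; lia.
  by rewrite Ea Ez -addrA -natrD; congr (_ + _%:R); lia.
have Ez := natr_val z s; apply/andP; split.
  by rewrite Ez; apply: gap_nonmem; rewrite le lt.
apply/existsP; exists s; rewrite start_block //; apply/existsP; exists t.
by rewrite start_block //= /before (@val_addn _ n_gt1 s t (next_dist s)).
Qed.

Lemma card_gap s : s \in starts -> (next_dist s < n)%N ->
  #|gap I (block s) (block (s + (next_dist s)%:R))| =
    (next_dist s - block_len s)%N.
Proof. by move=> sS lt; rewrite gap_block // card_range // ltnW. Qed.

Section Shifts.
Variable u : 'Z_n.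
Hypothesis shiftE : shiftI u I = I.

Lemma shift_memE x : (x + u \in val I) = (x \in val I).
Proof. by rewrite -{1}shiftE in_shiftI addrK. Qed.

Lemma shift_startE x : (x + u \in starts) = (x \in starts).
Proof. by rewrite !inE addrAC !shift_memE. Qed.

Lemma shift_block_lenE x : block_len (x + u) = block_len x.
Proof. by apply: eq_find => a; rewrite addrAC shift_memE. Qed.

Lemma shift_next_distE x : next_dist (x + u) = next_dist x.
Proof. by congr S; apply: eq_find => a; rewrite addrAC shift_startE. Qed.

End Shifts.

End Next.

Section CyclicIndex.
Local Open Scope ring_scope.
Variable r : nat.

Lemma addr_ordS (c i : 'I_r.+1) : c + ordS i = ordS (c + i).
Proof. by apply: val_inj; rewrite /= modnDmr addnS -[in RHS]addn1 modnDml
  addn1. Qed.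

Lemma ordS_ind (P : 'I_r.+1 -> Prop) :
  P 0 -> (forall i, P i -> P (ordS i)) -> forall i, P i.
Proof.
move=> P0 PS [i lt]; elim: i lt => [|i IH] lt.
  by rewrite (_ : Ordinal lt = 0) //; apply: val_inj.
rewrite (_ : Ordinal lt = ordS (Ordinal (ltnW lt))); first exact/PS/IH.
by apply: val_inj; rewrite /= modn_small.
Qed.

End CyclicIndex.

(** * Listings of the maximal intervals *)

Section Listing.
Local Open Scope ring_scope.
Variables (n k : nat) (n_gt1 : (1 < n)%N).
Hypothesis k_ltn : (k < n)%N.
Variable I : ksubset n k.
Local Notation next_dist := (next_dist I).
Local Notation block_len := (block_len I).
Local Notation block := (block I).
Local Notation starts := (starts I).
Variables (r : nat) (A : 'I_r.+1 -> {set 'Z_n}).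
Hypothesis r_gt0 : (0 < r)%N.
Hypothesis listA : interval_listing I A.

Lemma listing_starts : exists s : 'I_r.+1 -> 'Z_n,
  [/\ forall i, s i \in starts, forall i, A i = block (s i), injective s
    & forall x, x \in starts -> exists i, x = s i].
Proof.
have [injA maxA _] := listA.
have H i : exists s, s \in starts /\ A i = block s.
  have /(max_intervalP n_gt1 I k_ltn) [s sS E] : is_max_interval I (A i).
    by apply/maxA; exists i.
  by exists s.
have [s E] := fin_all_exists H; exists s; split.
- by move=> i; case: (E i).
- by move=> i; case: (E i).
- by move=> i j Es; apply: injA; rewrite (E i).2 (E j).2 Es.
move=> x xS; have /maxA [i Ei] : is_max_interval I (block x).
  by apply/(max_intervalP n_gt1 I k_ltn); exists x.
exists i; have [sS EA] := E i; rewrite EA in Ei.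
have lt1 : x \in block (s i) by rewrite -Ei start_block.
have lt2 : s i \in block x by rewrite Ei start_block.
rewrite !mem_block in lt1 lt2.
have [/eqP E0|p] := posnP (val (x - s i)); first
  by rewrite (natr_val x (s i)) (eqP E0) addr0.
have := @start_sep n k n_gt1 I (s i) (val (x - s i));
  rewrite -natr_val => /(_ xS p).
by rewrite leqNgt lt1.
Qed.

Variable s : 'I_r.+1 -> 'Z_n.
Hypotheses (sS : forall i, s i \in starts) (sA : forall i, A i = block (s i)).
Hypotheses (s_inj : injective s) (s_surj : forall x, x \in starts ->
  exists i, x = s i).

(** The cyclic order condition, applied with a the first start, says that the
starts are listed by increasing distance from it. *)
Lemma listing_mono (i j : 'I_r.+1) : (i < j)%N ->
  (val (s i - s 0)%R < val (s j - s 0)%R)%N.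
Proof.
have [_ _ ordA] := listA => lt.
have [i0|i0] := posnP i.
  have -> : i = 0 by apply: val_inj.
  rewrite subrr lt0n; apply/eqP => E; have /s_inj Ej : s j = s 0.
    by rewrite (natr_val (s j) (s 0)) E addr0.
  by rewrite Ej i0 in lt.
by apply: (ordA i j (s 0) (s i) (s j)); rewrite ?i0 // sA start_block.
Qed.

Lemma listing_le (i j : 'I_r.+1) :
  (val (s i - s 0)%R <= val (s j - s 0)%R)%N -> (i <= j)%N.
Proof. by move=> le; rewrite leqNgt; apply/negP => /listing_mono;
  rewrite ltnNge le. Qed.

(** The following start s j satisfies i < j by monotonicity, and s (i + 1)
cannot come before it; after the last index, one turns back to s 0. *)
Lemma listing_next i : s (ordS i) = s i + (next_dist (s i))%:R.
Proof.
have [tS tn] := next_distP n_gt1 (s i) (sS i).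
set o := fun j => val (s j - s 0).
have oE j : s j = s 0 + (o j)%:R by exact: natr_val.
have on j : (o j < n)%N by exact: val_lt.
have n0 : (0 < next_dist (s i))%N by [].
have [lt|ge] := ltnP i r.
  have Ei : ordS i = i.+1 :> nat by rewrite /= modn_small.
  have lto : (o i < o (ordS i))%N by apply: listing_mono; rewrite Ei.
  have le : (next_dist (s i) <= o (ordS i) - o i)%N.
    apply: next_dist_le; first by lia.
    by rewrite {1}oE -addrA -natrD subnKC ?(ltnW lto) // -oE.
  have [j Ej] := s_surj tS; rewrite Ej.
  have oj : o j = (o i + next_dist (s i))%N.
    apply: val_addn => //; first by rewrite natrD addrA -oE.
    by have := on (ordS i); lia.
  have l1 : (ordS i <= j)%N.
    rewrite Ei ltnNge; apply/negP => le2; have : (o j <= o i)%N.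
      by move: le2; rewrite leq_eqVlt =>
        /predU1P[/val_inj ->|/listing_mono /ltnW].
    by lia.
  have l2 : (j <= ordS i)%N.
    by apply: listing_le; rewrite -/(o j) -/(o (ordS i)); lia.
  by congr s; apply: val_inj; apply/eqP; rewrite eqn_leq; apply/andP.
(* For the last index the next start is s 0, at distance n - o i: a nearer one
would be listed after s i. *)
have Ei : i = r :> nat by have := ltn_ord i; lia.
have -> : ordS i = 0 by apply: val_inj; rewrite /= Ei modnn.
have le : (next_dist (s i) <= n - o i)%N.
  apply: next_dist_le; first by have := on i; lia.
  by rewrite {1}oE -addrA -natrD subnKC ?pchar_Zp ?addr0 // ltnW.
have [E|ne] := eqVneq (next_dist (s i)) (n - o i)%N.
  by rewrite E [X in X + _](oE i) -addrA -natrD subnKC ?pchar_Zp ?addr0 // ltnW.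
have [j Ej] := s_surj tS.
have oj : o j = (o i + next_dist (s i))%N.
  apply: val_addn => //; first by rewrite natrD addrA -oE.
  by lia.
have /listing_le : (o i <= o j)%N by rewrite oj leq_addr.
have := ltn_ord j; rewrite ltnS => le1 le2.
have Eij : i = j by apply: ord_inj; lia.
by rewrite -Eij in oj; lia.
Qed.

Lemma listing_next_lt i : (next_dist (s i) < n)%N.
Proof.
have [tS tn] := next_distP n_gt1 (s i) (sS i).
rewrite ltn_neqAle tn andbT; apply/eqP => E.
have := listing_next i; rewrite E pchar_Zp // addr0 => /s_inj /(congr1 val) /=.
have := ltn_ord i; rewrite ltnS leq_eqVlt => /predU1P[->|lt].
  by rewrite modnn => E0; move: r_gt0; rewrite -E0.
by rewrite modn_small // => /eqP; rewrite gtn_eqF.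
Qed.

Lemma listing_len i : ivl_len A i = block_len (s i).
Proof. by rewrite /ivl_len sA card_block. Qed.

Lemma listing_gap i : gap_len I A i = (next_dist (s i) - block_len (s i))%N.
Proof. by rewrite /gap_len !sA listing_next card_gap // listing_next_lt. Qed.

Lemma listing_len_gap i : (ivl_len A i + gap_len I A i)%N = next_dist (s i).
Proof. by rewrite listing_len listing_gap subnKC // ltnW // block_len_lt_next.
  Qed.

Lemma listing_sum (c : 'I_r.+1) :
  s c = s 0 + (\sum_(i < r.+1 | (i < c)%N) (ivl_len A i + gap_len I A i))%:R.
Proof.
case: c => c lt; elim: c lt => [|c IH] lt.
  rewrite big_pred0 // addr0; congr s; exact: val_inj.
have {}IH := IH (ltnW lt); set c' := Ordinal (ltnW lt) in IH.
have -> : Ordinal lt = ordS c' by apply: val_inj; rewrite /= modn_small.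
rewrite listing_next -listing_len_gap IH -addrA -natrD; congr (_ + _%:R).
rewrite [RHS](bigD1 c') /=; last by rewrite modn_small // ltnS.
rewrite addnC; congr (_ + _)%N; apply: eq_bigl => i /=.
by rewrite modn_small // ltnS [in RHS]leq_eqVlt -val_eqE /=; case: ltngtP.
Qed.

Lemma eq_modn_Zn a b : a = b %[mod n] <-> a%:R = b%:R :> 'Z_n.
Proof.
split=> [E|/(congr1 val) /=]; last by rewrite !val_Zp_nat.
by apply: val_inj; rewrite /= !val_Zp_nat.
Qed.

(** An equality of the sequences d and l with their rotations by c propagates
s c = s 0 + kt to s (c + i) = s i + kt for all i, and blocks of equal lengths
then correspond. Conversely a translation preserving I permutes the starts and
preserves d and l. *)
Lemma candidateP t : period_half_candidate I A t <->
  (0 < t)%N /\ shiftI (k * t)%:R I = I.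
Proof.
split=> [[t0 [c [Hd Hl Ec]]]|[t0 E]]; split=> //.
  set u : 'Z_n := (k * t)%:R.
  have Eu : s c = s 0 + u by rewrite listing_sum; congr (_ + _);
    apply/esym/eq_modn_Zn.
  have Es i : s (c + i) = s i + u.
    elim/ordS_ind: i => [|i IH]; first by rewrite addr0.
    by rewrite addr_ordS !listing_next -!listing_len_gap Hd Hl IH addrAC.
  apply: val_inj; apply/eqP; rewrite eqEcard !card_ksubset leqnn andbT.
  apply/subsetP => x; rewrite in_shiftI => /(mem_in_block n_gt1 k_ltn) [y yS].
  have [i ->] := s_surj yS; rewrite mem_block => lt.
  have -> : x = s (c + i) + (val (x - u - s i))%:R.
    by rewrite Es addrAC -natr_val subrK.
  by apply: block_len_mem; rewrite -listing_len Hd listing_len.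
set u : 'Z_n := (k * t)%:R in E.
have [c Ec] : exists c, s 0 + u = s c by apply: s_surj; rewrite shift_startE.
have Es i : s (c + i) = s i + u.
  elim/ordS_ind: i => [|i IH]; first by rewrite addr0.
  by rewrite addr_ordS !listing_next IH shift_next_distE // addrAC.
exists c; split.
- by move=> i; rewrite !listing_len Es shift_block_lenE.
- by move=> i; rewrite !listing_gap Es shift_block_lenE // shift_next_distE.
by apply/eq_modn_Zn; apply: (addrI (s 0)); rewrite -listing_sum -/u.
Qed.

End Listing.

Section ExistsListing.
Local Open Scope ring_scope.
Variables (n k : nat) (n_gt1 : (1 < n)%N).
Hypothesis k_ltn : (k < n)%N.
Variable I : ksubset n k.

(** The starts are listed by increasing distance from one of them. *)
Lemma exists_listing r : #|starts I| = r.+1 ->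
  exists A : 'I_r.+1 -> {set 'Z_n}, interval_listing I A.
Proof.
move=> cardS; have [s0 s0S] : exists s, s \in starts I.
  by apply/set0Pn; rewrite -card_gt0 cardS.
(* The distances from s0 to all starts, in increasing order. *)
pose M := [seq m <- iota 0 n | s0 + m%:R \in starts I].
have memM m : (m \in M) = (s0 + m%:R \in starts I) && (m < n)%N.
  by rewrite mem_filter mem_iota.
have sortM : sorted ltn M
  by rewrite sorted_filter ?iota_ltn_sorted //; exact: ltn_trans.
have uniqM : uniq M by rewrite filter_uniq // iota_uniq.
have sizeM : size M = r.+1.
  rewrite -cardS -(size_map (fun m => s0 + m%:R : 'Z_n)).
  have uM : uniq [seq s0 + m%:R : 'Z_n | m <- M].
    rewrite map_inj_in_uniq // => a b; rewrite !memM => /andP[_ la] /andP[_ lb].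
    by move/addrI => E; rewrite -(val_Zn n_gt1 la) E val_Zn.
  rewrite -(card_uniqP uM); apply: eq_card => x.
  apply/mapP/idP => [[m]|xS]; first by rewrite memM => /andP[mS _] ->.
  by exists (val (x - s0)); [rewrite memM -natr_val xS val_lt | exact:
    natr_val].
pose o (i : 'I_r.+1) := nth 0%N M i.
have oM i : o i \in M by rewrite mem_nth // sizeM.
have oS i : s0 + (o i)%:R \in starts I by have := oM i; rewrite memM => /andP[].
have on i : (o i < n)%N by have := oM i; rewrite memM => /andP[].
have o_lt (i j : 'I_r.+1) : (i < j)%N -> (o i < o j)%N.
  by move=> lt; apply: (sorted_ltn_nth ltn_trans) => //; rewrite inE sizeM.
have o0 : o ord0 = 0%N.
  rewrite /o /M; have -> : iota 0 n = 0%N :: iota 1 n.-1 by case: (n) n_gt1.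
  by rewrite /= addr0 s0S.
exists (fun i => block I (s0 + (o i)%:R)); split.
- move=> i j Eb; apply: contrapT => ne.
  wlog lt : i j Eb ne / (i < j)%N => [wl|].
    have [lt|lt|/ord_inj//] := ltngtP i j; first exact: (wl i j).
    by apply: (wl j i) => // E; case: ne.
  have := start_block n_gt1 k_ltn (oS j); rewrite -Eb mem_block.
  rewrite (@val_addn _ n_gt1 _ _ (o j - o i)%N); last by have := on j; lia.
    have := o_lt _ _ lt => olt; rewrite ltnNge (start_sep n_gt1) //; last
      by lia.
    by rewrite -addrA -natrD subnKC // ltnW.
  by rewrite -addrA -natrD subnKC // ltnW // o_lt.
- move=> S; split=> [/(max_intervalP n_gt1 I k_ltn) [x xS ->]|[i ->]];
  last first.
    by apply/(max_intervalP n_gt1 I k_ltn); exists (s0 + (o i)%:R).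
  have xM : val (x - s0) \in M by rewrite memM -natr_val xS val_lt.
  have lt : (index (val (x - s0)%R) M < r.+1)%N by rewrite -sizeM index_mem.
  by exists (Ordinal lt); rewrite /o /= nth_index // -natr_val.
move=> i j a b c /andP[i0 ij]; rewrite o0 addr0 !mem_block.
set al := val (a - s0); set be := val (b - _);
  set ga := val (c - _) => la lb lc.
have Ea : a = s0 + al%:R := natr_val _ _.
have Eb : b = s0 + (o i + be)%:R by rewrite natrD addrA; exact: natr_val.
have Ec : c = s0 + (o j + ga)%:R by rewrite natrD addrA; exact: natr_val.
have sep x (y : 'I_r.+1) : (x < o y)%N ->
  (block_len I (s0 + x%:R)%R <= o y - x)%N.
  move=> lt; apply: (start_sep n_gt1); last by lia.
  by rewrite -addrA -natrD subnKC // ltnW.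
have oi0 : (0 < o i)%N by rewrite -o0; apply: o_lt.
have sep0 := sep 0%N i oi0; rewrite addr0 in sep0.
have sepij := sep _ _ (o_lt _ _ ij).
have ej := block_end n_gt1 k_ltn s0S (erefl (s0 + (o j)%:R)) (on j).
rewrite /before (@val_addn _ n_gt1 a b (o i + be - al)%N); last by lia.
  rewrite (@val_addn _ n_gt1 a c (o j + ga - al)%N); [by lia| |by lia].
  by rewrite Ea Ec -addrA -natrD; congr (_ + _%:R); lia.
by rewrite Ea Eb -addrA -natrD; congr (_ + _%:R); lia.
Qed.

End ExistsListing.

(** * The period *)

Section Period.
Local Open Scope ring_scope.
Variables (n k : nat) (n_gt1 : (1 < n)%N) (k_gt0 : (0 < k)%N).
Variable I : ksubset n k.

Definition invariant_shift (t : nat) : bool := shiftI (k * t)%:R I == I.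

Lemma invariantB a b : invariant_shift a -> invariant_shift b -> (b <= a)%N ->
  invariant_shift (a - b).
Proof.
move=> /eqP Ea /eqP Eb le; apply/eqP.
rewrite -[in LHS]Eb shiftID -natrD -mulnDr subnK //.
Qed.

Lemma invariant_gcd : invariant_shift (n %/ gcdn n k).
Proof.
have -> : invariant_shift (n %/ gcdn n k) = (shiftI 0 I == I).
  congr (shiftI _ _ == _); rewrite gcdnC muln_divCA_gcd.
  by rewrite natrM pchar_Zp // mul0r.
by rewrite shiftI0.
Qed.

(** Exponents with this invariance are closed under subtraction, as in the
Euclidean algorithm. *)
Lemma least_divides t a : is_least (fun t =>
  (0 < t)%N /\ invariant_shift t) t ->
  invariant_shift a -> (t %| a)%N.
Proof.
case=> [[t0 It] tmin]; elim/ltn_ind: a => a IH Ia.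
have [->|a0] := posnP a; first exact: dvdn0.
have le := tmin a (conj a0 Ia).
have := IH (a - t)%N ltac:(lia) (invariantB Ia It le).
by rewrite dvdn_subl.
Qed.

End Period.

Theorem theorem2p9 (F : closedFieldType) (n k : nat) (n_gt1 : (1 < n)%N)
    (k_gt0 : (0 < k)%N) (k_ltn : (k < n)%N) (I : ksubset n k) (r : nat)
    (r_gt1 : (1 < r)%N) (rank_Omega : has_rank (Omega1 F n_gt1 I) r) :
  is_syzygy n_gt1 ((2 * n) %/ gcdn n k) I (rank1 F n_gt1 I) /\
  exists m : nat,
    [/\ is_period F n_gt1 I m,
        ~~ odd m,
        m %| (2 * n) %/ gcdn n k,
        exists A : 'I_r.+1 -> {set 'Z_n}, interval_listing I A
      & forall A : 'I_r.+1 -> {set 'Z_n}, interval_listing I A ->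
          exists2 t : nat, is_least (period_half_candidate I A) t & m = 2 * t].
Proof.
have r_gt0 : 0 < r by exact: ltnW.
have peaksE := rank_peaks k_ltn r_gt0 rank_Omega.
have evenE t : is_syzygy n_gt1 (2 * t) I (rank1 F n_gt1 I) <-> invariant_shift
  I t.
  by rewrite syzygy_self_even //; split=> /eqP.
have twoN : (2 * n) %/ gcdn n k = 2 * (n %/ gcdn n k).
  by rewrite muln_divA // dvdn_gcdl.
have Ig := invariant_gcd n_gt1 I.
have g0 : 0 < n %/ gcdn n k.
  by rewrite divn_gt0 ?gcdn_gt0 ?k_gt0 ?orbT // dvdn_leq ?dvdn_gcdl //; lia.
split; first by rewrite twoN; apply/evenE.
have ex : exists t, (0 < t) && invariant_shift I t.
  by exists (n %/ gcdn n k); rewrite g0.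
case: (ex_minnP ex) => t /andP[t0 It] tmin.
have tleast : is_least (fun t => (0 < t) /\ invariant_shift I t) t.
  by split=> // s [s0 Is]; apply: tmin; rewrite s0.
exists (2 * t); split.
- split; first by lia.
    exact/evenE.
  move=> m m0; case: (boolP (odd m)) => [om|]; last first.
    move=> em; rewrite -[m]odd_double_half (negPf em) add0n -mul2n => /evenE Im.
    rewrite leq_mul2l /=; apply: tmin; rewrite Im andbT.
    by rewrite -[m]odd_double_half (negPf em) in m0; lia.
  move/(syzygy_self_odd k_gt0 k_ltn) => H; exfalso; apply: H => //.
  by rewrite peaksE.
- by rewrite mul2n odd_double.
- by rewrite twoN dvdn_pmul2l //; apply: least_divides Ig.
- by apply: exists_listing => //; rewrite card_starts.
move=> A listA; exists t => //.
have [s [sS sA s_inj s_surj]] := listing_starts n_gt1 k_ltn listA.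
have cP := candidateP n_gt1 k_ltn r_gt0 listA sS sA s_inj s_surj.
split; first by apply/cP; split=> //; apply/eqP.
by move=> u /cP [u0 /eqP Iu]; apply: tmin; rewrite u0.
Qed.
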